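(* Let $\boldsymbol u=(u_j)_{j\ge1}$ be a sequence of real numbers with $u_1\ge u_2\ge\cdots>0$. For $s\in\mathbb N$ consider integration over $\mathcal F_{s,\boldsymbol u}$, and let $e(n,s,\mathcal F_{s,\boldsymbol u})$ be the $n$-th minimal worst-case error. Then the following hold. 1. There exist positive constants $c_{5,s}$ and $c_{6,s}$ depending on $s$ and $\boldsymbol u$ such that $$e(n,s,\mathcal F_{s,\boldsymbol u})\le c_{5,s}\exp\left(-c_{6,s}(\log n)^2\right)\quad\text{for all } s,n\in\mathbb N.$$ 2. Let $1<p<2$ be a real number. If $\liminf_{j\to\infty}\log(u_j^{-1})/j^{(p-1)/(2-p)}>0$, then there exist constants $C\ge0$ and $c>0$ such that $$e(n,s,\mathcal F_{s,\boldsymbol u})\le C e^{-c(\log n)^p}\quad\text{for all } s,n\in\mathbb N.$$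
   Context: $\mathbb N$ is the set of positive integers and $\mathbb N_0=\mathbb N\cup\{0\}$. Function space: $\mathcal F_{s,\boldsymbol u}$ is the space of real-valued $f\in C^\infty[0,1]^s$ with $$\|f\|_{\mathcal F_{s,\boldsymbol u}}:=\sup_{\boldsymbol\alpha=(\alpha_1,\dots,\alpha_s)\in\mathbb N_0^s}\frac{\|f^{(\boldsymbol\alpha)}\|_{L^1}}{\prod_{j=1}^su_j^{\alpha_j}}<\infty,\qquad f^{(\boldsymbol\alpha)}=\frac{\partial^{|\boldsymbol\alpha|}f}{\partial x_1^{\alpha_1}\cdots\partial x_s^{\alpha_s}},$$ where the $L^1$ norm is over $[0,1]^s$. Minimal error: let $I(f)=\int_{[0,1)^s}f(\boldsymbol x)\,d\boldsymbol x$. An algorithm using $n$ function values is $A_{n,s}(f)=\phi_{n,s}(f(\boldsymbol t_1),\dots,f(\boldsymbol t_n))$ with arbitrary $\boldsymbol t_i\in[0,1)^s$ and arbitrary $\phi_{n,s}:\mathbb R^n\to\mathbb R$. For a normed function space $\mathcal H$, $e^{\mathrm{wor}}(A_{n,s},\mathcal H)=\sup_{f\in\mathcal H,\|f\|_{\mathcal H}\le1}|I(f)-A_{n,s}(f)|$ and $e(n,s,\mathcal H)=\inf_{A_{n,s}}e^{\mathrm{wor}}(A_{n,s},\mathcal H)$, the infimum being over all algorithms using $n$ function values. *)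

(* Defs.v *)
From HB Require Import structures.
From mathcomp Require Import all_boot all_order all_algebra.
From mathcomp Require Import all_classical all_reals all_analysis.
Set Implicit Arguments.
Unset Strict Implicit.
Unset Printing Implicit Defensive.
Import Order.TTheory GRing.Theory Num.Theory.
Import numFieldNormedType.Exports.
Local Open Scope classical_set_scope.
Local Open Scope ring_scope.

(* MathComp-Analysis only has the one-dimensional Lebesgue measure. The
   s-dimensional one is built here, on the Borel sets of the tuples R^s, by
   iterated products: the measure on R^(n+1) is the image of the product
   measure on R * R^n under (a, t) |-> a :: t. *)
Section lebesgue_tuple_def.
Variable R : realType.
Local Notation RR := (measurableTypeR R).

Definition tuple_cons (n : nat) (p : RR * n.-tuple RR) : n.+1.-tuple RR :=
  [tuple of p.1 :: p.2].

Lemma measurable_tuple_cons (n : nat) : measurable_fun setT (@tuple_cons n).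
Proof. exact: measurable_cons. Qed.

Section step.
Variables (n : nat) (mu : {measure set (n.-tuple RR) -> \bar R}).

Definition cons_measure : set (n.+1.-tuple RR) -> \bar R :=
  pushforward (product_measure2 (@lebesgue_measure R) mu) (@tuple_cons n).

Let mcons := @measurable_tuple_cons n.

Let cons_measure0 : cons_measure set0 = 0%E.
Proof. exact: (@measure0 _ _ _
  (measure_function_pushforward__canonical__measure_function_Measure _ mcons)).
Qed.

Let cons_measure_ge0 A : (0 <= cons_measure A)%E.
Proof. exact: (@measure_ge0 _ _ _
  (measure_function_pushforward__canonical__measure_function_Measure _ mcons)).
Qed.

Let cons_measure_sigma_additive : semi_sigma_additive cons_measure.
Proof. exact: (@measure_semi_sigma_additive _ _ _
  (measure_function_pushforward__canonical__measure_function_Measure _ mcons)).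
Qed.

HB.instance Definition _ := isMeasure.Build _ _ _ cons_measure
  cons_measure0 cons_measure_ge0 cons_measure_sigma_additive.

End step.

Fixpoint lebesgue_tuple (n : nat) : {measure set (n.-tuple RR) -> \bar R} :=
  match n with
  | 0 => dirac [tuple]
  | m.+1 => cons_measure (lebesgue_tuple m)
  end.

End lebesgue_tuple_def.

Section function_space.
Variables (R : realType) (s : nat).

Definition unit_cube : set 'rV[R]_s := [set x | forall i, 0 <= x 0 i <= 1].

Definition half_open_cube : set 'rV[R]_s := [set x | forall i, 0 <= x 0 i < 1].

(* Points are row vectors for the topology and tuples for the measure. *)
Definition row_of_tuple (t : s.-tuple (measurableTypeR R)) : 'rV[R]_s :=
  \row_i tnth t i.

(* A function on [0,1]^s is represented by f : 'rV[R]_s -> R; only its values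
   on the cube matter. Accordingly, partial derivatives are taken within the
   cube (increments leading out of it are ignored), so that they are one-sided
   at the faces. *)
Definition diff_quotient (i : 'I_s) (f : 'rV[R]_s -> R) (x : 'rV[R]_s)
  (h : R) : R := h^-1 * (f (x + h *: delta_mx 0 i) - f x).

Definition increments (i : 'I_s) (x : 'rV[R]_s) : set_system R :=
  within [set h | unit_cube (x + h *: delta_mx 0 i)] (0 : R)^'.

Definition partial (i : 'I_s) (f : 'rV[R]_s -> R) (x : 'rV[R]_s) : R :=
  lim (diff_quotient i f x @ increments i x).

Definition partial_exists (i : 'I_s) (f : 'rV[R]_s -> R) (x : 'rV[R]_s) :
  Prop := cvg (diff_quotient i f x @ increments i x).

Definition smooth_cube (f : 'rV[R]_s -> R) : Prop :=
  forall l : seq 'I_s,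
    let g := foldr partial f l in
    {within unit_cube, continuous g} /\
    forall (i : 'I_s) (x : 'rV[R]_s), unit_cube x -> partial_exists i g x.

Definition mixed_partial (alpha : 'I_s -> nat) (f : 'rV[R]_s -> R) :
  'rV[R]_s -> R :=
  foldr (fun i g => iter (alpha i) (partial i) g) f (enum 'I_s).

Definition L1norm (g : 'rV[R]_s -> R) : \bar R :=
  (\int[lebesgue_tuple R s]_(t in row_of_tuple @^-1` unit_cube)
     `|g (row_of_tuple t)|%:E)%E.

(* The weights are indexed from 1 and coordinates from 0, hence [u j.+1]. *)
Definition Fnorm (u : nat -> R) (f : 'rV[R]_s -> R) : \bar R :=
  ereal_sup (range (fun alpha : 'I_s -> nat =>
    (L1norm (mixed_partial alpha f) *
     ((\prod_(j < s) u j.+1 ^+ alpha j)^-1)%:E)%E)).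

Definition Fspace (u : nat -> R) : set ('rV[R]_s -> R) :=
  [set f | smooth_cube f /\ (Fnorm u f < +oo)%E].

End function_space.

Section minimal_error.
Variables (R : realType) (s : nat).

Definition cube_integral (f : 'rV[R]_s -> R) : R :=
  \int[lebesgue_tuple R s]_(t in @row_of_tuple R s @^-1` @half_open_cube R s)
     f (row_of_tuple t).

Definition algorithm (n : nat) (t : 'I_n -> 'rV[R]_s) (phi : 'rV[R]_n -> R)
  (f : 'rV[R]_s -> R) : R := phi (\row_k f (t k)).

Definition worst_case_error (H : set ('rV[R]_s -> R))
    (norm : ('rV[R]_s -> R) -> \bar R) (A : ('rV[R]_s -> R) -> R) : \bar R :=
  ereal_sup [set `|cube_integral f - A f|%:E |
              f in [set f | H f /\ (norm f <= 1)%E]].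

Definition minimal_error (n : nat) (H : set ('rV[R]_s -> R))
    (norm : ('rV[R]_s -> R) -> \bar R) : \bar R :=
  ereal_inf [set e | exists (t : 'I_n -> 'rV[R]_s) (phi : 'rV[R]_n -> R),
    (forall k, half_open_cube (t k)) /\
    e = worst_case_error H norm (algorithm t phi)].

End minimal_error.

Definition F_minimal_error (R : realType) (n s : nat) (u : nat -> R) : \bar R :=
  minimal_error n (@Fspace R s u) (@Fnorm R s u).

(* Main.v *)
(** Let f, g in the unit ball agree at the points (t_(al_1), ..., t_(al_s)), t_k = 1/(k+2), for all multi-indices
    al with a_1 al_1 + ... + a_s al_s < L; then the value I(f) can be returned for g, and it suffices to bound
    h = f - g. Expand h in the Newton basis with nodes t_k in the first variable. By Rolle, the k-th coefficient
    is, as a function of the other variables, at most sup |d_1^k h| / k!, and a sup over the first variable is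
    at most the L1 norms over [0,1] of the function and of its derivative. Hence this coefficient satisfies the
    same L1 hypotheses in dimension s - 1, with the factor (1 + u_1) u_1^k / k! <= C_1 (1 + u_1) e^(-k a_1), and
    vanishes at the nodes of level L - k a_1. By induction on s, |h| <= 2 e^(-L/2) prod_j (1 + u_j) C_j /
    (1 - e^(-a_j/2)).
    The number of nodes is at most e^(d L) prod_j 1/(1 - e^(-d a_j)) <= exp(d L + r! d^(-r) sum_j a_j^(-r)) for
    every d > 0 and every integer r > 0. If sum_j a_j^(-r) is bounded and (p - 1) r <= 1, then L of order
    (log n)^p and d of order (log n)^(1-p) give at most n nodes. Take a_j = 1, r = 1, p = 2 for fixed s, and
    a_j = c j^((p-1)/(2-p)), r = floor(1/(p-1)) for the bound uniform in s. *)

Require Import Defs.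
From HB Require Import structures.
From mathcomp Require Import all_boot all_order all_algebra.
From mathcomp Require Import all_classical all_reals all_analysis.
From mathcomp Require Import measurable_realfun ring lra.
Set Implicit Arguments.
Unset Strict Implicit.
Unset Printing Implicit Defensive.
Import Order.TTheory GRing.Theory Num.Theory.
Import numFieldNormedType.Exports.
Local Open Scope classical_set_scope.
Local Open Scope ring_scope.

(** * Functions of one variable on [0,1] *)

Section one_variable.
Context {R : realType}.
Implicit Types (f g : R -> R) (x y : R).

(* As in [partial], increments leaving [0,1] are ignored, so that the derivative is one-sided at 0 and 1. *)
Definition der01 f f' := forall x, 0 <= x <= 1 ->
  h^-1 * (f (x + h) - f x) @[h --> within [set h | 0 <= x + h <= 1] 0^'] --> f' x.

Lemma der01_lin f f' g g' (a b : R) : der01 f f' -> der01 g g' ->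
  der01 (fun x => a * f x + b * g x) (fun x => a * f' x + b * g' x).
Proof.
move=> df dg x x01.
rewrite [X in X @ _](_ : _ = fun h => a * (h^-1 * (f (x + h) - f x)) +
   b * (h^-1 * (g (x + h) - g x))); last by apply/funext => h; ring.
apply: cvgD; apply: cvgMr.
- exact: df.
- exact: dg.
Qed.

Lemma is_derive_der01 f f' : (forall x, is_derive x 1 f (f' x)) -> der01 f f'.
Proof.
move=> df x x01; apply: cvg_within_filter.
have := @ex_derive _ _ _ _ _ _ _ (df x); rewrite /derivable => /cvg_ex[l hl].
have <- : l = f' x.
  by rewrite -(@derive_val _ _ _ _ _ _ _ (df x)); apply/esym/cvg_lim.
move: hl; rewrite [X in X @ _ --> _ -> _](_ : _ = fun h => h^-1 * (f (x + h) - f x))//.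
by apply/funext => h /=; rewrite [h%:A]mulr1 (addrC h).
Qed.

Lemma der01_horner (p : {poly R}) : der01 (horner p) (horner p^`()).
Proof.
apply: is_derive_der01 => x; exact: DeriveDef.
Qed.

(** Near x the difference quotient differs from f'(x) by less than 1, so |f y - f x| is at most
    (|f'(x)| + 1) |y - x|. *)
Lemma der01_within f f' : der01 f f' -> {within `[0, 1], continuous f}.
Proof.
move=> df; apply/subspace_continuousP => x; rewrite /= in_itv /= => x01.
have /cvgrPdist_lt/(_ 1 ltr01) := df x x01.
rewrite near_withinE => /nbhs_ballP[d/= d0 hd].
apply/cvgrPdist_lt => e e0; rewrite near_withinE.
pose K := `|f' x| + 1.
have K0 : 0 < K by rewrite ltr_wpDl.
near=> y; rewrite /= in_itv/= => y01.
have [->|yx] := eqVneq y x; first by rewrite subrr normr0.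
have yd : `|x - y| < d by near: y; exact: cvgr_dist_lt.
have ye : `|x - y| < e / K.
  by near: y; apply: cvgr_dist_lt => //; rewrite divr_gt0.
have := hd (y - x); rewrite /ball/= sub0r opprB => /(_ yd).
rewrite subr_eq0 => /(_ yx); rewrite addrCA subrr addr0 => /(_ y01) h.
rewrite distrC -(mulVKf (_ : y - x != 0) (f y - f x)) ?subr_eq0// normrM.
set q := (X in `|_ - X| < 1) in h.
have qK : `|q| <= K.
  by rewrite -lerBlDl; apply/ltW; apply: le_lt_trans h; rewrite distrC lerB_dist.
rewrite distrC in ye; apply: le_lt_trans (_ : `|y - x| * K < e).
  by rewrite ler_wpM2l.
by rewrite -ltr_pdivlMr.
Unshelve. all: by end_near. Qed.

(** At an interior point all small increments stay in [0,1], so the one-sided restriction is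
    eventually void. *)
Lemma der01_is_derive f f' x : der01 f f' -> 0 < x < 1 -> is_derive x 1 f (f' x).
Proof.
move=> df /andP[x0 x1].
have h : (h^-1 *: (f (h *: 1 + x) - f x) @[h --> 0^']) --> f' x.
  have := df x; rewrite !ltW// => /(_ isT) /cvgrPdist_lt hd.
  apply/cvgrPdist_lt => e e0; have := hd e e0.
  rewrite near_withinE => he; near=> h.
  rewrite /= [h *: 1]mulr1 (addrC h); near: h.
  have : \forall h \near (0:R)^', 0 <= x + h <= 1.
    near=> h.
    have h0 : `|h| < Num.min x (1 - x).
      by near: h; apply: dnbhs0_lt; rewrite lt_min x0 subr_gt0.
    by move: h0; rewrite lt_min => /andP[]; rewrite !ltr_norml; lra.
  by move: he; apply: filterS2 => h; apply.
apply: DeriveDef; first by apply/cvg_ex; exists (f' x).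
exact/cvg_lim.
Unshelve. all: by end_near. Qed.

Lemma der01_Rolle f f' a b : der01 f f' -> 0 <= a -> a < b -> b <= 1 ->
  f a = 0 -> f b = 0 -> exists2 c, a < c < b & f' c = 0.
Proof.
move=> df a0 ab b1 fa fb.
have sub x : a < x < b -> 0 < x < 1.
  by move=> /andP[ax xb]; rewrite (le_lt_trans a0)// (lt_le_trans xb).
have [|||c] := @Rolle _ f a b ab.
- by move=> x; rewrite in_itv/= => /sub x01; case: (der01_is_derive df x01).
- apply: continuous_subspaceW (der01_within df) => x/=.
  by rewrite !in_itv/= => /andP[ax xb]; rewrite (le_trans a0)// (le_trans xb).
- by rewrite fa fb.
rewrite in_itv/= => cab dc; exists c => //.
by rewrite -(@derive_val _ _ _ _ _ _ _ (der01_is_derive df (sub _ cab))) derive_val.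
Qed.

(** Rolle between consecutive zeros. The new zeros interlace the old ones strictly, so they stay
    sorted and in [0,1], and one zero is lost. *)
Lemma path_zeros f f' a s : der01 f f' -> 0 <= a -> path <%R a s ->
  all (fun x => x <= 1) s -> f a = 0 -> all (fun x => f x == 0) s ->
  exists s', [/\ size s' = size s, path <%R a s',
                 all (fun x => x <= 1) s' & all (fun x => f' x == 0) s'].
Proof.
move=> df; elim: s a => [|b s IH] a a0 /=; first by exists [::].
move=> /andP[ab bs] /andP[b1 s1] fa /andP[/eqP fb fs].
have [c /andP[ac cb] f'c] := der01_Rolle df a0 ab b1 fa fb.
have [s' [ss' ps' s'1 fs']] := IH b (le_trans a0 (ltW ab)) bs s1 fb fs.
exists (c :: s'); split => /=; first by rewrite ss'.
- rewrite ac/=; case: s' ps' {ss' s'1 fs'} => //= d s' /andP[bd ->].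
  by rewrite (lt_trans cb).
- by rewrite s'1 (ltW (lt_le_trans cb b1)).
- by rewrite f'c eqxx.
Qed.

Lemma Rolle_iter (f : nat -> R -> R) m s : (forall k, der01 (f k) (f k.+1)) ->
  size s = m.+1 -> sorted <%R s -> all (fun x => 0 <= x <= 1) s ->
  all (fun x => f 0 x == 0) s -> exists2 c, 0 <= c <= 1 & f m c = 0.
Proof.
elim: m f s => [|m IH] f [|a s]//= df [ss].
  case: s ss => //= _ _ /andP[a01 _] /andP[/eqP fa _].
  by exists a.
move=> ps /andP[/andP[a0 a1]] s01 /andP[/eqP fa fs].
have s1 : all (fun x => x <= 1) s.
  by apply: sub_all s01 => x /andP[].
have [[|b s'] [ss' ps' s'1 fs']] := path_zeros (df 0) a0 ps s1 fa fs.
  by rewrite ss in ss'.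
have {}ss' : size s' = m by move: ss' => /=; rewrite ss => -[].
have [|||||c c01 fc] := IH (fun k => f k.+1) (b :: s').
- by move=> k; exact: df.
- by rewrite /= ss'.
- by case/andP: ps'.
- apply/allP => x xs; have /allP/(_ x xs) := s'1; move=> ->; rewrite andbT.
  have := order_path_min lt_trans ps'; move=> /allP/(_ x xs) ax.
  exact: le_trans a0 (ltW ax).
- by [].
by exists c.
Qed.

End one_variable.

(** * Newton interpolation and its error on [0,1] *)

Section newton_interpolation.
Context {R : realType}.
Implicit Types (f g : R -> R) (x y : R).

(** The shift by 2 keeps every node strictly below 1, as sampling points in [half_open_cube] must
    be. *)
Definition node (k : nat) : R := k.+2%:R^-1.

Lemma node_gt0 k : 0 < node k. Proof. by rewrite invr_gt0 ltr0n. Qed.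

Lemma node_lt1 k : node k < 1.
Proof. by rewrite invf_lt1 ?ltr0n// ltr1n. Qed.

Lemma node01 k : 0 <= node k <= 1.
Proof. by rewrite !ltW ?node_gt0 ?node_lt1. Qed.

Lemma node_inj : injective node.
Proof. by move=> i j /invr_inj/eqP; rewrite eqr_nat => /eqP[]. Qed.

Definition omega (m : nat) : {poly R} := \prod_(l < m) ('X - (node l)%:P).

Lemma omegaS m : omega m.+1 = omega m * ('X - (node m)%:P).
Proof. by rewrite /omega big_ord_recr. Qed.

Lemma omegaE m x : (omega m).[x] = \prod_(l < m) (x - node l).
Proof. by rewrite horner_prod; apply: eq_bigr => l _; rewrite hornerXsubC. Qed.

Lemma omega_monic m : omega m \is monic.
Proof. by apply: monic_prod => l _; exact: monicXsubC. Qed.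

Lemma size_omega m : size (omega m) = m.+1.
Proof. by rewrite size_prod_XsubC /index_enum -enumT size_enum_ord. Qed.

Lemma omega_eq0 m x : ((omega m).[x] == 0) = (x \in [seq node l | l <- iota 0 m]).
Proof.
elim: m => [|m IH]; first by rewrite omegaE big_ord0 oner_eq0.
rewrite omegaS hornerM mulf_eq0 IH hornerXsubC subr_eq0.
by rewrite -addn1 iotaD map_cat mem_cat /= add0n mem_seq1.
Qed.

Lemma omega_node_neq0 m : (omega m).[node m] != 0.
Proof.
rewrite omega_eq0; apply/mapP => -[l]; rewrite mem_iota add0n /= => lm /node_inj.
by move=> ml; rewrite ml ltnn in lm.
Qed.

Lemma normr_omega_le1 m x : 0 <= x <= 1 -> `|(omega m).[x]| <= 1.
Proof.
move=> x01; elim: m => [|m IH]; first by rewrite omegaE big_ord0 normr1.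
rewrite omegaS hornerM normrM mulr_ile1// hornerXsubC ler_norml.
by have := node01 m; lra.
Qed.

(** Newton's form of the interpolation polynomial at the first m nodes: [omega k] vanishes at the
    earlier nodes, so the added multiple corrects the value at [node k] without disturbing them. *)
Fixpoint newton f (m : nat) : {poly R} := if m is k.+1 then
  newton f k + ((f (node k) - (newton f k).[node k]) / (omega k).[node k]) *: omega k
  else 0.

(** This is the divided difference of [f] at the nodes 0 to k. *)
Definition newton_coef f k :=
  (f (node k) - (newton f k).[node k]) / (omega k).[node k].

Lemma newtonS f m : newton f m.+1 = newton f m + newton_coef f m *: omega m.
Proof. by []. Qed.

Lemma newtonE f m x :
  (newton f m).[x] = \sum_(k < m) newton_coef f k * (omega k).[x].
Proof.
elim: m => [|m IH]; first by rewrite big_ord0 horner0.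
by rewrite newtonS hornerD hornerZ big_ord_recr/= IH.
Qed.

Lemma size_newton f m : (size (newton f m) <= m)%N.
Proof.
elim: m => [|m IH]; first by rewrite size_poly0.
rewrite newtonS (leq_trans (size_polyD _ _))// geq_max (leq_trans IH)//=.
by rewrite (leq_trans (size_scale_leq _ _))// size_omega.
Qed.

Lemma newton_node f m l : (l < m)%N -> (newton f m).[node l] = f (node l).
Proof.
elim: m => // m IH; rewrite ltnS leq_eqVlt newtonS hornerD hornerZ.
case/orP => [/eqP ->|lm].
  by rewrite /newton_coef divfK ?omega_node_neq0// addrC subrK.
rewrite (IH lm); have /eqP -> : (omega m).[node l] == 0; last by rewrite mulr0 addr0.
by rewrite omega_eq0 map_f// mem_iota.
Qed.

Lemma derivn_omega m : (omega m)^`(m) = m`!%:R%:P.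
Proof.
apply/polyP => i; rewrite coef_derivn coefC.
case: i => [|i] /=.
  have := omega_monic m; rewrite monicE lead_coefE size_omega addn0 => /eqP ->.
  by rewrite ffactnn.
by rewrite nth_default ?mul0rn// size_omega addnS ltnS leq_addr.
Qed.

(* Rolle for f 0 - newton - lam * omega, where lam makes x a further zero. *)
Lemma newton_error (f : nat -> R -> R) m x : (forall k, der01 (f k) (f k.+1)) ->
  0 <= x <= 1 -> exists2 c, 0 <= c <= 1 &
  f 0%N x - (newton (f 0%N) m).[x] = (omega m).[x] * (f m c / m`!%:R).
Proof.
move=> df x01.
have [|xn] := boolP (x \in [seq node l | l <- iota 0 m]).
  move=> xm; have := xm; rewrite -omega_eq0 => /eqP ->.
  case/mapP: xm => l; rewrite mem_iota/= add0n => lm ->.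
  by exists 0; rewrite ?lexx ?ler01// newton_node// subrr mul0r.
have o0 : (omega m).[x] != 0 by rewrite omega_eq0.
pose lam := (f 0%N x - (newton (f 0%N) m).[x]) / (omega m).[x].
pose p := newton (f 0%N) m + lam *: omega m.
pose g k y := 1 * f k y + (-1) * (p^`(k)).[y].
have dg k : der01 (g k) (g k.+1).
  by apply: der01_lin => //; rewrite derivnS; exact: der01_horner.
pose zs := x :: [seq node l | l <- iota 0 m].
have uz : uniq zs by rewrite /= xn map_inj_uniq ?iota_uniq//; exact: node_inj.
have [||||c c01 gc] := @Rolle_iter _ g m (sort <=%R zs) dg.
- by rewrite size_sort /= size_map size_iota.
- by rewrite sort_lt_sorted.
- rewrite all_sort /= x01/=; apply/allP => y /mapP[l _ ->]; exact: node01.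
- rewrite all_sort; apply/allP => y; rewrite inE /g/p derivn0 hornerD hornerZ.
  move=> /orP[/eqP ->|].
    by rewrite /lam divfK// mul1r mulN1r addrCA subrr addr0 subrr.
  move=> yn; have := yn; rewrite -omega_eq0 => /eqP ->.
  move: yn => /mapP[l]; rewrite mem_iota add0n /= => lm ->.
  by rewrite newton_node// mulr0 addr0 mul1r mulN1r subrr.
exists c => //.
(* The interpolation polynomial has degree below m and disappears in the m-th derivative, while
   [omega m] leaves m!; hence [f m c] is [lam] times m!. *)
move: gc; rewrite /g /p derivnD derivnZ derivn_omega hornerD hornerZ hornerC.
rewrite (derivn_poly0 (size_newton _ _)) horner0 add0r mul1r mulN1r => /subr0_eq ->.
rewrite mulfK ?pnatr_eq0 -?lt0n ?fact_gt0//.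
by rewrite /lam mulrC divfK.
Qed.

Local Notation mu := (@lebesgue_measure R).
Local Notation I01 := (`[0%R : R, 1%R : R]%classic).

Lemma measurable_der01 f f' : der01 f f' -> measurable_fun I01 f.
Proof.
by move=> df; apply: subspace_continuous_measurable_fun => //; exact: der01_within df.
Qed.

(** The second derivative makes [f'] continuous, as the fundamental theorem of calculus requires;
    the integral is then enlarged from [a,b] to [0,1]. *)
Lemma der01_FTC f f' f'' a b : der01 f f' -> der01 f' f'' -> 0 <= a -> a < b ->
  b <= 1 -> (`|f b - f a|%:E <= \int[mu]_(x in I01) `|f' x|%:E)%E.
Proof.
move=> df df' a0 ab b1.
have sub : `[a, b] `<=` I01.
  by move=> x/=; rewrite !in_itv/= => /andP[ax xb]; rewrite (le_trans a0)// (le_trans xb).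
have cf : {within `[a, b], continuous f} by apply: continuous_subspaceW (der01_within df).
have cf' : {within `[a, b], continuous f'} by apply: continuous_subspaceW (der01_within df').
have dfi x : x \in `]a, b[ -> is_derive x 1 f (f' x).
  rewrite in_itv/= => /andP[ax xb]; apply: der01_is_derive => //.
  by rewrite (le_lt_trans a0)// (lt_le_trans xb).
have := @continuous_FTC2 R f' f a b ab cf'.
have [_ fa fb] := (continuous_within_itvP _ ab).1 cf.
have H : derivable_oo_LRcontinuous f a b.
  by split => // x /dfi [].
move=> /(_ H) E; rewrite -abse_EFin EFinB -E; last first.
  by move=> x /dfi dfx; rewrite derive1E; exact: derive_val.
apply: (@le_trans _ _ (\int[mu]_(x in `[a, b]) `|f' x|%:E)%E).
  apply: le_abse_integral => //; apply/measurable_EFinP.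
  exact: subspace_continuous_measurable_fun.
apply: ge0_subset_integral => //.
by apply/measurable_EFinP/measurableT_comp => //; exact: measurable_der01 df'.
Qed.

(** Average |f x| <= |f y| + |f x - f y| over y in [0,1], the last term being at most the L1 norm of
    [f']. *)
Lemma der01_le_integral f f' f'' x : der01 f f' -> der01 f' f'' -> 0 <= x <= 1 ->
  (`|f x|%:E <= \int[mu]_(y in I01) `|f y|%:E +
                \int[mu]_(y in I01) `|f' y|%:E)%E.
Proof.
move=> df df' x01; set K := (X in (_ <= _ + X)%E).
have m01 : mu I01 = 1%E by rewrite lebesgue_measure_itv/= lte_fin ltr01 sube0.
have K0 : (0 <= K)%E by apply: integral_ge0.
have H y : y \in `[0, 1] -> (`|f x|%:E <= `|f y|%:E + K)%E.
  rewrite in_itv/= => y01.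
  have : (`|f x - f y|%:E <= K)%E.
    have [xy|yx|->] := ltgtP x y.
    - by rewrite distrC; apply: der01_FTC df df' _ xy _; lra.
    - by apply: der01_FTC df df' _ yx _; lra.
    - by rewrite subrr normr0.
  move=> h; apply: (@le_trans _ _ (`|f y|%:E + `|f x - f y|%:E)%E); last exact: leeD2l.
  rewrite -EFinD lee_fin; have := ler_normD (f y) (f x - f y).
  by rewrite addrCA subrr addr0.
rewrite -[leLHS]mule1 -m01 -integral_cst//.
have -> : K = (\int[mu]_(x in I01) cst K x)%E.
  by rewrite integral_cst// -[LHS]mule1; congr (_ * _)%E; exact: esym m01.
rewrite -ge0_integralD//; last first.
  by apply/measurable_EFinP/measurableT_comp => //; exact: measurable_der01 df.
apply: ge0_le_integral => //=; apply: emeasurable_funD => //.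
by apply/measurable_EFinP/measurableT_comp => //; exact: measurable_der01 df.
Qed.

End newton_interpolation.

(** * Integration over tuples *)

Section tuple_integral.
Context {R : realType}.
Local Notation RR := (measurableTypeR R).
Local Notation mu := (@lebesgue_measure R).
Local Notation lam := (@lebesgue_tuple R).
Local Notation I01 := (`[0%R : R, 1%R : R]%classic).

(** [lebesgue_tuple] is only declared as a measure; this attaches the sigma-finite structure that
    Tonelli's theorem asks for. *)
Definition sigma_finite_pack d (T : measurableType d) (m : {measure set T -> \bar R})
    (sm : sigma_finite setT m) : {sigma_finite_measure set T -> \bar R} :=
  HB.pack_for (SigmaFiniteMeasure.type T R) (Measure.sort m)
    (isSFinite.Build d T R m (sfinite_measure_sigma_finite sm))
    (isSigmaFinite.Build d T R m sm).

Lemma lebesgue_tuple_sigma_finite s : sigma_finite setT (lam s).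
Proof.
elim: s => [|s IH].
  exists (fun=> setT); first by rewrite bigcup_const//; exists 0%N.
  move=> k; split => //=.
  by apply: le_lt_trans (ltry 1); rewrite /= diracE; case: (_ \in _); rewrite lee_fin.
pose lam' := sigma_finite_pack IH.
have /sigma_finiteP[F [TF ndF Foo]] := sigma_finiteT mu.
have /sigma_finiteP[G [TG ndG Goo]] := sigma_finiteT lam'.
exists (fun k => [set t : s.+1.-tuple RR | F k (thead t) /\ G k [tuple of behead t]]).
  apply/seteqP; split => // t _.
  have : [set: RR] (thead t) by [].
  rewrite TF => -[i _ Fi].
  have : [set: s.-tuple RR] [tuple of behead t] by [].
  rewrite TG => -[j _ Gj].
  (* Both sequences are nondecreasing, so the larger index serves for the two factors. *)
  exists (maxn i j) => //; split.
    by move: (thead t) Fi; exact/subsetPset/ndF/leq_maxl.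
  by move: Gj; move: [tuple of _]; exact/subsetPset/ndG/leq_maxr.
move=> k; have [mF Fk] := Foo k; have [mG Gk] := Goo k; split.
  apply: measurableI.
    by rewrite -[X in measurable X]setTI; exact: (@measurable_tnth _ _ _ ord0).
  by rewrite -[X in measurable X]setTI; exact: (@measurable_behead _ _ s).
rewrite /= /cons_measure /pushforward.
rewrite (_ : _ @^-1` _ = F k `*` G k); last first.
  apply/seteqP; split=> -[x y]/= [h1 h2]; split => //=.
    by move: h2; congr (G k _); exact: val_inj.
  by move: h2; congr (G k _); exact: val_inj.
by rewrite product_measure2E// lte_mul_pinfty// ge0_fin_numE.
Qed.

Lemma tonelli_tuple s (h : s.+1.-tuple RR -> \bar R) :
  measurable_fun setT h -> (forall t, 0 <= h t)%E ->
  measurable_fun setT (fun y => \int[mu]_x h (tuple_cons (x, y)))%E /\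
  (\int[lam s.+1]_t h t = \int[lam s]_y \int[mu]_x h (tuple_cons (x, y)))%E.
Proof.
move=> mh h0.
pose lam' := sigma_finite_pack (lebesgue_tuple_sigma_finite s).
have mc := @measurable_tuple_cons R s.
have mhc : measurable_fun setT (h \o @tuple_cons R s) by exact: measurableT_comp.
split.
  by apply: (@measurable_fun_fubini_tonelli_G _ _ _ _ _ mu _ mhc) => z; exact: h0.
rewrite [LHS](_ : _ = \int[pushforward (mu \x^ lam')%E (@tuple_cons R s)]_t h t)%E//.
rewrite ge0_integral_pushforward//=.
rewrite preimage_setT.
(* [cons_measure] uses the product measure defined by integrating in the other order; by uniqueness
   for sigma-finite factors the two agree. *)
rewrite (@eq_measure_integral _ _ _ setT (mu \x lam')%E); last first.
  move=> A mA _; apply/esym.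
  by apply: product_measure_unique => // B C mB mC; exact: product_measure2E.
by rewrite (@fubini_tonelli2 _ _ _ _ _ mu lam').
Qed.
End tuple_integral.

(** * The unit cube as a set of tuples *)

Section cube.
Context {R : realType}.
Local Notation RR := (measurableTypeR R).
Local Notation mu := (@lebesgue_measure R).
Local Notation lam := (@lebesgue_tuple R).
Local Notation I01 := (`[0%R : R, 1%R : R]%classic).

Definition in01 (x : R) := 0 <= x <= 1.

(** The condition is put on the underlying list, so that a coordinate can be split off by list
    operations alone. *)
Definition cube s : set (s.-tuple RR) := [set t | all in01 t].

Lemma measurable_cube s : measurable (@cube s).
Proof.
rewrite (_ : @cube s = \big[setI/setT]_(i < s) ((fun t => tnth t i) @^-1` I01)).
  apply: bigsetI_measurable => i _; rewrite -[X in measurable X]setTI.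
  exact: measurable_tnth.
rewrite -bigcap_seq; apply/seteqP; split => [t /all_tnthP h i _|t h].
  by rewrite /= in_itv/=; exact: h.
apply/all_tnthP => i.
by have := h i; rewrite /= in_itv/=; apply; rewrite mem_index_enum.
Qed.

Lemma measurable_cube_slice s x (F : seq R -> R) : in01 x ->
  measurable_fun (@cube s.+1) (fun t => F t) ->
  measurable_fun (@cube s) (fun t => F (x :: t)).
Proof.
move=> x01 mF.
pose c (t : s.-tuple RR) := tuple_cons (x : RR, t).
apply: (@measurable_comp _ _ _ _ _ _ (@cube s.+1) (fun t : s.+1.-tuple RR => F t) _ c).
- exact: measurable_cube.
- by move=> _ [t /= ht <-]; rewrite /cube/= x01.
- exact: mF.
apply: measurable_funTS.
apply: (@measurableT_comp _ _ _ _ _ _ (@tuple_cons R s) _ (fun t => (x : RR, t))).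
  exact: measurable_tuple_cons.
exact: pair1_measurable.
Qed.

Lemma tonelli_cube s (h : seq R -> \bar R) :
  measurable_fun (@cube s.+1) (fun t => h t) ->
  (forall t, 0 <= h t)%E ->
  measurable_fun (@cube s) (fun y => \int[mu]_(x in I01) h (x :: y))%E /\
  (\int[lam s.+1]_(t in @cube s.+1) h t =
   \int[lam s]_(y in @cube s) \int[mu]_(x in I01) h (x :: y))%E.
Proof.
move=> mh h0.
(* Extension by zero outside the cube reduces the claim to Tonelli's theorem on the whole space. *)
have mh' : measurable_fun setT ((fun t : s.+1.-tuple RR => h t) \_ (@cube s.+1)).
  by apply/(measurable_restrictT _ _).1 => //; exact: measurable_cube.
have [|m1 e1] := tonelli_tuple mh'.
  by move=> t; rewrite patchE; case: ifP.
have e2 y : (\int[mu]_x ((fun t : s.+1.-tuple RR => h t) \_ (@cube s.+1)) (tuple_cons (x, y)) =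
   ((fun y : s.-tuple RR => \int[mu]_(x in I01) h (x :: y)) \_ (@cube s)) y)%E.
  rewrite patchE; case: ifPn => ycube.
    rewrite [RHS]integral_mkcond; apply: eq_integral => x _; rewrite !patchE.
    congr (if _ then _ else _); move: ycube; rewrite !inE /cube/= => yc.
    by apply/idP/idP; rewrite !inE /= in_itv/= yc andbT.
  rewrite integral0_eq// => x _; rewrite patchE; case: ifPn => //.
  by rewrite inE /cube /= => /andP[_ yc]; move: ycube; rewrite notin_setE; case.
split.
  apply/(measurable_restrictT _ _).2; first exact: measurable_cube.
  by apply: eq_measurable_fun m1 => y _; rewrite e2.
rewrite integral_mkcond e1 [RHS]integral_mkcond.
by apply: eq_integral => y _; rewrite e2.
Qed.

Lemma cube_volume s : lam s (@cube s) = 1%E.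
Proof.
rewrite -[LHS]mul1e -integral_cst; last exact: measurable_cube.
elim: s => [|s IH].
  rewrite integral_cst; last exact: measurable_cube.
  by rewrite mul1e /= diracE mem_set.
have -> := (@tonelli_cube s (cst 1%E) (measurable_cst _) (fun=> lee01)).2.
rewrite -[RHS]IH; apply: eq_integral => y _.
by rewrite integral_cst//= mul1e lebesgue_measure_itv/= lte_fin ltr01 sube0.
Qed.

End cube.

(** * Jets of smooth functions *)

Section jets.
Context {R : realType}.
Local Notation RR := (measurableTypeR R).
Local Notation mu := (@lebesgue_measure R).
Local Notation lam := (@lebesgue_tuple R).
Local Notation I01 := (`[0%R : R, 1%R : R]%classic).
Implicit Types (F G : seq nat -> seq R -> R).

(* F al x stands for the derivative of order al at x. The derivative in direction i is only required at orders
   vanishing before i: these are the ones obtained from [mixed_partial] without interchanging derivatives. *)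
Definition jet s F :=
  (forall al, size al = s -> measurable_fun (@cube R s) (fun t => F al t)) /\
  (forall i k be x y, (i + (size be).+1 = s)%N -> size x = i ->
    size y = size be -> all in01 x -> all in01 y ->
    der01 (fun z => F (nseq i 0%N ++ k :: be) (x ++ z :: y))
          (fun z => F (nseq i 0%N ++ k.+1 :: be) (x ++ z :: y))).

Definition cubeL1 s (g : seq R -> R) : \bar R :=
  (\int[lam s]_(t in @cube R s) `|g t|%:E)%E.

Lemma jet_lin s F G a b : jet s F -> jet s G ->
  jet s (fun al x => a * F al x + b * G al x).
Proof.
move=> [mF dF] [mG dG]; split => [al sal|i k be x y h sx sy x01 y01].
  by apply: measurable_funD; apply: measurable_funM => //; [exact: mF|exact: mG].
by apply: der01_lin; [exact: dF|exact: dG].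
Qed.

(** The prefix of zero orders in [jet] grows by one; this is the passage from dimension s + 1 to
    s. *)
Lemma jet_slice s F x : jet s.+1 F -> in01 x ->
  jet s (fun be y => F (0%N :: be) (x :: y)).
Proof.
move=> [mF dF] x01; split => [al sal|i k be y z h sy sz y01 z01].
  by apply: (measurable_cube_slice (F := F (0%N :: al))) => //; apply: mF => /=; rewrite sal.
apply: (dF i.+1 k be (x :: y) z) => //=; rewrite ?addSn ?h ?sy//.
by rewrite y01 andbT.
Qed.

(** The Newton polynomial in the first variable, evaluated at z, is a linear combination of slices
    of F at the nodes. *)
Lemma jet_newton s F m z : jet s.+1 F ->
  jet s (fun be y => (newton (fun t => F (0%N :: be) (t :: y)) m).[z]).
Proof.
move=> jF; elim: m z => [|m IH] z.
  have := jet_lin 0 0 (jet_slice jF (node01 0)) (jet_slice jF (node01 0)).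
  rewrite [X in jet s X -> _](_ : _ = fun be y => 0); last first.
    by apply/funext => be; apply/funext => y; ring.
  rewrite [X in _ -> jet s X](_ : _ = fun be y => 0)//.
  by apply/funext => be; apply/funext => y; rewrite horner0.
have := jet_lin 1 ((omega m).[z] / (omega m).[node m]) (IH z)
  (jet_lin 1 (-1) (jet_slice jF (node01 m)) (IH (node m))).
rewrite [X in jet s X -> _](_ : _ = fun be y => 
  (newton (fun t => F (0%N :: be) (t :: y)) m.+1).[z])//.
apply/funext => be; apply/funext => y.
rewrite newtonS hornerD hornerZ /newton_coef; ring.
Qed.

Lemma cubeL1_scale s c (g : seq R -> R) : measurable_fun (@cube R s) (fun t => g t) ->
  cubeL1 s (fun y => c * g y) = (`|c|%:E * cubeL1 s g)%E.
Proof.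
move=> mg; rewrite /cubeL1 -ge0_integralZl//.
- by apply: eq_integral => y _; rewrite normrM EFinM.
- exact: measurable_cube.
- exact/measurable_EFinP/measurableT_comp.
Qed.

Lemma cubeL1_newton_error s F m x ga : jet s.+1 F -> in01 x -> size ga = s ->
  (cubeL1 s (fun y => F (0%N :: ga) (x :: y) -
                 (newton (fun t => F (0%N :: ga) (t :: y)) m).[x])%R <=
   (`|(omega m).[x]| / m`!%:R)%:E *
     (cubeL1 s.+1 (F (m :: ga)) + cubeL1 s.+1 (F (m.+1 :: ga))))%E.
Proof.
move=> jF x01 sga; have [mF dF] := jF.
pose K k y := (\int[mu]_(t in I01) `|F (k :: ga) (t :: y)|%:E)%E.
have mabs k : measurable_fun (@cube R s.+1) (fun t => `|F (k :: ga) t|%:E).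
  by apply/measurable_EFinP/measurableT_comp => //; apply: mF; rewrite /= sga.
have abs0 k (t : seq R) : (0 <= `|F (k :: ga) t|%:E)%E by rewrite lee_fin.
have tK k := tonelli_cube (h := fun t => `|F (k :: ga) t|%:E) (mabs k) (abs0 k).
have K0 k y : (0 <= K k y)%E by exact: integral_ge0.
have c0 : 0 <= `|(omega m).[x]| / m`!%:R by rewrite divr_ge0.
have -> : (cubeL1 s.+1 (F (m :: ga)) + cubeL1 s.+1 (F (m.+1 :: ga)) =
    \int[lam s]_(y in @cube R s) (K m y + K m.+1 y))%E.
  rewrite ge0_integralD//; first by rewrite /cubeL1 !(tK _).2.
  - exact: measurable_cube.
  - exact: (tK m).1.
  - exact: (tK m.+1).1.
have mKK : measurable_fun (@cube R s) (fun y => K m y + K m.+1 y)%E.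
  by apply: emeasurable_funD; [exact: (tK m).1|exact: (tK m.+1).1].
rewrite -ge0_integralZl//; last 2 first.
- exact: measurable_cube.
- by move=> y _; exact: adde_ge0.
apply: ge0_le_integral => //.
- exact: measurable_cube.
- have [m1 _] := jet_lin 1 (-1) (jet_slice jF x01) (jet_newton m x jF).
  apply/measurable_EFinP/measurableT_comp => //.
  apply: eq_measurable_fun (m1 ga sga) => y _.
  by rewrite mul1r mulN1r.
- by apply: emeasurable_funM.
move=> y y01.
have dd k : der01 (fun t => F (k :: ga) (t :: y)) (fun t => F (k.+1 :: ga) (t :: y)).
  by apply: (dF 0%N k ga [::] y) => //; rewrite ?add0n ?sga// size_tuple.
have [c c01 ->] := newton_error (f := fun k t => F (k :: ga) (t :: y)) m dd x01.
rewrite !normrM normfV (ger0_norm (ler0n _ _)) (mulrC `|F _ _|) mulrA EFinM.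
rewrite lee_wpmul2l//; exact: der01_le_integral.
Qed.

End jets.

(** * Pointwise bound for jets that vanish at the nodes *)

Section main_estimate.
Context {R : realType}.
Implicit Types (F : seq nat -> seq R -> R) (u a C : nat -> R).

(** Entries of [u] are counted from 0, so that dropping the first variable replaces [u] by
    [u \o S]. *)
Definition monom u (al : seq nat) : R := \prod_(j < size al) u j ^+ nth 0%N al j.

Definition weight a (al : seq nat) : R := \sum_(j < size al) a j * (nth 0%N al j)%:R.

Lemma monom_cons u k be : monom u (k :: be) = u 0%N ^+ k * monom (u \o S) be.
Proof. by rewrite /monom /= big_ord_recl. Qed.

Lemma weight_cons a k be :
  weight a (k :: be) = a 0%N * k%:R + weight (a \o S) be.
Proof. by rewrite /weight /= big_ord_recl. Qed.

Lemma monom_ge0 u al : (forall j, 0 <= u j) -> 0 <= monom u al.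
Proof. by move=> u0; apply: prodr_ge0 => j _; rewrite exprn_ge0. Qed.

Lemma weight_ge0 a al : (forall j, 0 < a j) -> 0 <= weight a al.
Proof. by move=> a0; apply: sumr_ge0 => j _; rewrite mulr_ge0// ltW. Qed.

Lemma newton_eq0 (f : R -> R) m :
  (forall l, (l < m)%N -> f (node l) = 0) -> newton f m = 0.
Proof.
elim: m => [//|m IH] f0; rewrite newtonS IH => [|l lm]; last by apply: f0; rewrite ltnS ltnW.
rewrite /newton_coef IH => [|l lm]; last by apply: f0; rewrite ltnS ltnW.
by rewrite f0// horner0 subrr mul0r scale0r addr0.
Qed.

Lemma sum_geom_le (q : R) m : 0 <= q -> q < 1 -> \sum_(k < m) q ^+ k <= (1 - q)^-1.
Proof.
move=> q0 q1; have q1' : 0 < 1 - q by rewrite subr_gt0.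
rewrite -div1r ler_pdivlMr//.
suff -> : (\sum_(k < m) q ^+ k) * (1 - q) = 1 - q ^+ m by rewrite gerBl exprn_ge0.
elim: m => [|m IH]; first by rewrite big_ord0 mul0r expr0 subrr.
by rewrite big_ord_recr/= mulrDl IH exprS; ring.
Qed.

Lemma le_of_geom (X Y D q : R) : 0 <= q -> q < 1 ->
  (forall m, X <= Y + D * q ^+ m) -> X <= Y.
Proof.
move=> q0 q1 H.
have c : (fun m => Y + D * q ^+ m) @ \oo --> Y.
  rewrite -[X in _ --> X]addr0 -[X in _ --> _ + X](mulr0 D).
  apply: cvgD; first exact: cvg_cst.
  by apply: cvgMr; apply: cvg_expr; rewrite ger0_norm.
rewrite -(cvg_lim _ c)//; apply: limr_ge; first exact: cvgP c.
by near=> m; exact: H.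
Unshelve. all: by end_near. Qed.

(** The factor c allows two uses: c = 1 gives the Newton remainder at z, and z = [node m] with c the
    inverse of the value of [omega m] there gives the m-th Newton coefficient. *)
Lemma jet_newton_error s F m z c : jet s.+1 F -> in01 z ->
  jet s (fun be y => c * (F (0%N :: be) (z :: y) -
                          (newton (fun t => F (0%N :: be) (t :: y)) m).[z])).
Proof.
move=> jF z01.
have := jet_lin c (- c) (jet_slice jF z01) (jet_newton m z jF).
congr (jet s _); apply/funext => be; apply/funext => y; ring.
Qed.

(** The orders m and m + 1 in the first variable together contribute u_0^m (1 + u_0); the bound on c
    times the nodal polynomial holds in both uses of c. *)
Lemma cubeL1_newton_error_le s F m z c u B ga : jet s.+1 F -> in01 z ->
  (forall j, 0 <= u j) -> 0 <= B ->
  (forall al, size al = s.+1 -> (cubeL1 s.+1 (F al) <= (B * monom u al)%:E)%E) ->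
  `|c * (omega m).[z]| <= 1 -> size ga = s ->
  (cubeL1 s (fun y => c * (F (0%N :: ga) (z :: y) -
                 (newton (fun t => F (0%N :: ga) (t :: y)) m).[z]))%R <=
  (B * (1 + u 0%N) * (u 0%N ^+ m / m`!%:R) * monom (u \o S) ga)%:E)%E.
Proof.
move=> jF z01 u0 B0 hF hc sga.
rewrite cubeL1_scale; last first.
  have [m1 _] := jet_newton_error m 1 jF z01.
  by apply: eq_measurable_fun (m1 ga sga) => y _; rewrite mul1r.
have h1 := cubeL1_newton_error m jF z01 sga.
have h2 := hF (m :: ga); have h3 := hF (m.+1 :: ga).
rewrite /= sga in h2 h3; have {h2 h3} h := leeD (h2 erefl) (h3 erefl).
rewrite !monom_cons -EFinD in h.
have w0 : 0 <= `|(omega m).[z]| / m`!%:R by rewrite divr_ge0.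
have {}h := le_trans h1 (lee_wpmul2l (w0 : 0 <= _%:E)%E h).
apply: (le_trans (lee_wpmul2l (normr_ge0 c : 0 <= _%:E)%E h)).
rewrite -!EFinM lee_fin.
set M := monom _ _.
rewrite [leLHS](_ : _ = `|c * (omega m).[z]| *
   (B * (1 + u 0%N) * (u 0%N ^+ m / m`!%:R) * M)); last by rewrite normrM exprS; ring.
have M0 : 0 <= M by apply: monom_ge0 => j; exact: u0.
by rewrite ler_piMl// !mulr_ge0// ?addr_ge0 ?exprn_ge0 ?invr_ge0.
Qed.

(** Each variable contributes 1 + u_j from passing from L1 norms to values, C_j from bounding u_j^k
    / k!, and the sum of a geometric series of ratio e^(-a_j/2). *)
Definition err_const u a C s : R :=
  \prod_(j < s) ((1 + u j) * C j / (1 - expR (- a j / 2))).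

Lemma err_constS u a C s : err_const u a C s.+1 =
  (1 + u 0%N) * C 0%N / (1 - expR (- a 0%N / 2)) *
  err_const (u \o S) (a \o S) (C \o S) s.
Proof. by rewrite /err_const big_ord_recl. Qed.

(* The remainder after m Newton terms is bounded by the induction hypothesis with L = 0, and tends to 0 as m
   grows. *)
Lemma jet_bound s u a C F B L x :
  (forall j, 0 <= u j) -> (forall j, 0 < a j) ->
  (forall j k, u j ^+ k / k`!%:R <= C j * expR (- (a j * k%:R))) ->
  0 <= B -> jet s F ->
  (forall al, size al = s -> (cubeL1 s (F al) <= (B * monom u al)%:E)%E) ->
  (forall al, size al = s -> weight a al < L ->
     F (nseq s 0%N) [seq node l | l <- al] = 0) ->
  size x = s -> all in01 x ->
  `|F (nseq s 0%N) x| <= B * expR (- L / 2) * err_const u a C s.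
Proof.
elim: s u a C F B L x => [|s IH] u a C F B L x u0 a0 uC B0 jF hF Fz.
  move=> /size0nil -> _ /=; rewrite /err_const big_ord0 mulr1.
  (* In dimension 0 the empty multi-index has weight 0: for L > 0 the value vanishes, otherwise
     e^(-L/2) is at least 1. *)
  have [L0|L0] := ltP 0 L.
    rewrite (Fz [::])// ?normr0 ?mulr_ge0 ?expR_ge0//.
    by rewrite /weight big_ord0.
  apply: (@le_trans _ _ B); last first.
    by rewrite ler_peMr// -expR0 ler_expR divr_ge0// oppr_ge0.
  have := hF [::] erefl; rewrite /monom big_ord0 mulr1 /cubeL1 /=.
  rewrite (integral_dirac _ (@measurable_cube R 0)); last first.
    by apply/measurable_EFinP/measurableT_comp => //; exact: jF.1.
  by rewrite diracE mem_set// mul1e lee_fin.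
case: x => [//|x y] [sy] /andP[x01 y01].
set u' := u \o S; set a' := a \o S; set C' := C \o S.
have C0 j : 0 <= C j.
  have := uC j 0%N; rewrite expr0 fact0 mulr0 oppr0 expR0 mulr1 divr1.
  exact: le_trans.
have E1 j : 0 < 1 - expR (- a j / 2).
  by rewrite subr_gt0 expR_lt1 pmulr_llt0// oppr_lt0.
have Q0 : 0 <= err_const u' a' C' s.
  apply: prodr_ge0 => j _; apply: divr_ge0; last exact: (ltW (E1 j.+1)).
  by rewrite mulr_ge0 ?addr_ge0//; [exact: (u0 j.+1)|exact: (C0 j.+1)].
set Q := err_const u' a' C' s in Q0 *.
pose D := B * (1 + u 0%N) * C 0%N * Q.
have D0 : 0 <= D by rewrite !mulr_ge0// addr_ge0.
pose q := expR (- a 0%N / 2).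
have q0 : 0 <= q by exact: expR_ge0.
have q1 : q < 1 by rewrite -subr_gt0; exact: E1.
have qn k : expR (- (a 0%N * k%:R) / 2) = q ^+ k.
  by rewrite -expRM_natl; congr expR; ring.
have qq k : expR (- (a 0%N * k%:R)) = q ^+ k * q ^+ k.
  by rewrite -qn -expRD; congr expR; field.
pose phi t := F (nseq s.+1 0%N) (t :: y).
(* The induction hypothesis in the form used twice: for the remainder at x, and for the k-th
   coefficient with L' = L - a_0 k. Vanishing is asked at z and at the earlier nodes, so that the
   interpolant vanishes too. *)
have step m z c L' : in01 z -> `|c * (omega m).[z]| <= 1 ->
    (forall be, size be = s -> weight a' be < L' ->
      F (nseq s.+1 0%N) (z :: [seq node l | l <- be]) = 0 /\
      forall l, (l < m)%N ->
      F (nseq s.+1 0%N) (node l :: [seq node l | l <- be]) = 0) ->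
    `|c * (phi z - (newton phi m).[z])| <= D * (q ^+ m * q ^+ m) * expR (- L' / 2).
  move=> z01 hc hz.
  have := IH u' a' C' _ (B * (1 + u 0%N) * (u 0%N ^+ m / m`!%:R)) L' y
    (fun j => u0 j.+1) (fun j => a0 j.+1) (fun j => uC j.+1) _
    (jet_newton_error m c jF z01)
    (fun ga sga => cubeL1_newton_error_le jF z01 u0 B0 hF hc sga) _ sy y01.
  move=> h; apply: (le_trans (h _ _)).
  - by rewrite !mulr_ge0// ?addr_ge0 ?exprn_ge0 ?invr_ge0.
  - move=> be sbe /(hz be sbe)[e1 e2]; rewrite [F _ _]e1 newton_eq0//.
    by rewrite horner0 subrr mulr0.
  - rewrite [leRHS](_ : _ = B * (1 + u 0%N) * (C 0%N * (q ^+ m * q ^+ m)) *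
       expR (- L' / 2) * Q); last by rewrite /D; ring.
    rewrite ler_wpM2r// ler_wpM2r ?expR_ge0// ler_wpM2l ?mulr_ge0 ?addr_ge0//.
    by rewrite -qq.
apply: (@le_of_geom _ _ D q) => // m.
have -> : F (nseq s.+1 0%N) (x :: y) =
    (newton phi m).[x] + 1 * (phi x - (newton phi m).[x]).
  by rewrite mul1r addrC subrK.
rewrite (le_trans (ler_normD _ _))// lerD//; last first.
  have := @step m x 1 0 x01; rewrite mul1r => /(_ (normr_omega_le1 _ x01)).
  rewrite oppr0 mul0r expR0 mulr1 => h; apply: le_trans (h _) _.
    move=> be _ /lt_le_trans/(_ (weight_ge0 be (fun j => a0 j.+1))).
    by rewrite ltxx.
  by rewrite ler_wpM2l// ler_piMr ?exprn_ge0// exprn_ile1// ltW.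
rewrite newtonE (le_trans (ler_norm_sum _ _ _))//.
apply: (@le_trans _ _ (\sum_(k < m) D * expR (- L / 2) * q ^+ k)).
  apply: ler_sum => k _; rewrite normrM.
  apply: (@le_trans _ _ `|newton_coef phi k|); first by rewrite ler_piMr// normr_omega_le1.
  rewrite /newton_coef mulrC.
  have := @step k (node k) (omega k).[node k]^-1 (L - a 0%N * k%:R) (node01 k).
  rewrite mulVf ?omega_node_neq0// normr1 => /(_ (lexx _)) h.
  apply: le_trans (h _) _.
    move=> be sbe hw; split => [|l lk].
      by apply: (Fz (nat_of_ord k :: be)); rewrite /= ?sbe// weight_cons addrC -ltrBrDr.
    apply: (Fz (l :: be)); rewrite /= ?sbe// weight_cons addrC -ltrBrDr.
    apply: (lt_le_trans hw); rewrite lerB// ler_wpM2l ?ltW//.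
    by rewrite ltr_nat.
  (* Lowering the level by a_0 k costs q^(-k), while the bound on u_0^k / k! supplies q^(2k). The
     surviving q^k is summable, which is why the exponent is L/2. *)
  rewrite opprB mulrBl expRD -mulNr.
  have -> : a 0%N * k%:R / 2 = - (- (a 0%N * k%:R) / 2) by rewrite !mulNr opprK.
  rewrite expRN qn [leLHS](_ : _ = D * expR (- L / 2) * q ^+ k * (q ^+ k / q ^+ k)); last by ring.
  by rewrite divff ?mulr1// expf_neq0// gt_eqF// expR_gt0.
rewrite -mulr_sumr err_constS -/Q -/q.
rewrite [leRHS](_ : _ = D * expR (- L / 2) * (1 - q)^-1); last by rewrite /D; ring.
apply: ler_wpM2l; first by rewrite mulr_ge0 ?expR_ge0.
exact: sum_geom_le.
Qed.

End main_estimate.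

(** * Counting nodes *)

Section counting.
Context {R : realType}.
Implicit Types (u a c : nat -> R).

(** Each such multi-index satisfies 1 <= e^(d (L - weight)), and the sum of this over all
    multi-indices is a product of geometric series. The induction splits off the first entry. *)
Lemma multiindices_below s a (L d : R) : (forall j, 0 < a j) -> 0 < d ->
  exists l : seq (seq nat),
    (forall al, size al = s -> weight a al < L -> al \in l) /\
    (size l)%:R <= expR (d * L) * \prod_(j < s) (1 - expR (- (d * a j)))^-1.
Proof.
elim: s a L => [|s IH] a L a0 d0.
  rewrite big_ord0 mulr1; have [L0|L0] := ltP 0 L.
    exists [:: [::]]; split => [al /size0nil -> //|/=].
    by rewrite -expR0 ler_expR mulr_ge0// ltW.
  exists [::]; split => [al /size0nil ->|/=]; last exact: expR_ge0.
  by rewrite /weight big_ord0 ltNge L0.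
(* From M on, the level left for the other entries is at most 0, so only first entries below M
   occur. *)
have [M hM] : exists M, forall k, (M <= k)%N -> L - a 0%N * k%:R <= 0.
  exists (Num.truncn (L / a 0%N)).+1 => k Mk.
  rewrite subr_le0 -ler_pdivrMl// mulrC.
  by apply/ltW; apply: lt_le_trans (truncnS_gt _) _; rewrite ler_nat.
have /choice[f hf] := fun k : nat => IH (a \o S) (L - a 0%N * k%:R)
  (fun j => a0 j.+1) d0.
exists (flatten [seq [seq k :: be | be <- f k] | k <- iota 0 M]); split.
  move=> [//|k be] [sbe]; rewrite weight_cons addrC -ltrBrDr => w.
  apply/flatten_mapP; exists k; last by apply/map_f/(hf k).1.
  rewrite mem_iota add0n /=; case: (ltnP k M) => // /hM h.
  have := weight_ge0 be (fun j => a0 j.+1).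
  by rewrite leNgt (lt_le_trans w).
set q := expR (- (d * a 0%N)).
have q1 : q < 1 by rewrite expR_lt1 oppr_lt0 mulr_gt0.
rewrite size_flatten /shape -map_comp sumnE big_map.
rewrite -[M]subn0 -/(index_iota 0 M) big_mkord natr_sum big_ord_recl.
set P := \prod_(j < s) _.
have P0 : 0 <= P.
  apply: prodr_ge0 => j _; rewrite invr_ge0 subr_ge0 ltW// expR_lt1 oppr_lt0.
  by rewrite mulr_gt0.
apply: (@le_trans _ _ (\sum_(k < M) (expR (d * L) * P) * q ^+ k)).
  apply: ler_sum => k _; rewrite /= size_map; apply: le_trans (hf k).2 _.
  rewrite -/P mulrBr expRD mulrAC ler_wpM2l ?mulr_ge0 ?expR_ge0//.
  by rewrite -expRM_natl ler_expR le_eqVlt; apply/orP; left; apply/eqP; ring.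
rewrite -mulr_sumr [leRHS](_ : _ = expR (d * L) * P * (1 - q)^-1); last first.
  by rewrite -[RHS]mulrA (mulrC P).
apply: ler_wpM2l; first by rewrite mulr_ge0 ?expR_ge0.
by apply: sum_geom_le => //; exact: expR_ge0.
Qed.

(* 1 / (1 - e^(-x)) = 1 + 1 / (e^x - 1) and e^x - 1 >= x^r / r!. *)
Lemma inv_1BexpR_le (x : R) r : 0 < x -> (0 < r)%N ->
  (1 - expR (- x))^-1 <= expR (r`!%:R * (x ^+ r)^-1).
Proof.
move=> x0 r0.
have e1 : x ^+ r / r`!%:R <= expR x - 1.
  by rewrite lerBrDl; move: r0; case: r => // r _; exact/expR_ge1Dxn/ltW.
have y0 : 0 < x ^+ r / r`!%:R by rewrite divr_gt0 ?exprn_gt0 ?ltr0n ?fact_gt0.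
have y1 := lt_le_trans y0 e1.
rewrite (le_trans _ (expR_ge1Dx _))//.
rewrite expRN -[X in 1 - X]mul1r -[X in X - _](@divff _ (expR x)) ?gt_eqF ?expR_gt0//.
rewrite -mulrBl invfM invrK.
rewrite (_ : _ * expR x = 1 + (expR x - 1)^-1); last first.
  by field; rewrite gt_eqF.
rewrite lerD2l -[leRHS]invrK lef_pV2 ?posrE//.
  by rewrite invfM invrK mulrC.
by rewrite invr_gt0 -[_ * _]invrK invfM invrK mulrC invr_gt0.
Qed.

(** Every factor is bounded by an exponential, using 1 + u <= e^u and [inv_1BexpR_le] at a_j / 2,
    whence 2^r. Since r! 2^r >= 1, this factor may also be put on u_j and c_j. *)
Lemma err_const_le s u a c r A : (0 < r)%N ->
  (forall j, 0 <= u j) -> (forall j, 0 < a j) -> (forall j, 0 <= c j) ->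
  \sum_(j < s) (u j + c j + (a j ^+ r)^-1) <= A ->
  err_const u a (expR \o c) s <= expR (r`!%:R * 2 ^+ r * A).
Proof.
move=> r0 u0 a0 c0 hA.
have f1 : 1 <= r`!%:R * 2 ^+ r :> R.
  by rewrite mulr_ege1 ?exprn_ege1 ?ler1n ?fact_gt0.
apply: (@le_trans _ _ (\prod_(j < s)
    expR (r`!%:R * 2 ^+ r * (u j + c j + (a j ^+ r)^-1)))).
  apply: ler_prod => j _.
  have e1 : 0 < 1 - expR (- a j / 2).
    by rewrite subr_gt0 expR_lt1 pmulr_llt0// oppr_lt0.
  apply/andP; split.
    by apply: divr_ge0; [rewrite mulr_ge0 ?addr_ge0 ?expR_ge0|exact: ltW].
  apply: (@le_trans _ _ (expR (u j) * expR (c j) *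
      expR (r`!%:R * ((a j / 2) ^+ r)^-1))).
    rewrite ler_pM ?mulr_ge0 ?addr_ge0 ?expR_ge0 ?invr_ge0 ?(ltW e1)//.
      by rewrite ler_wpM2r ?expR_ge0// expR_ge1Dx.
    by rewrite mulNr; apply: inv_1BexpR_le => //; rewrite divr_gt0.
  rewrite -!expRD ler_expR mulrDr lerD//.
    by rewrite ler_peMl// addr_ge0.
  by rewrite expr_div_n invf_div mulrA.
by rewrite -expR_sum ler_expR -mulr_sumr ler_wpM2l.
Qed.

(* Chosen so that 2 * rate <= 1 and r! * A * (2 * rate) <= 1/2. *)
Definition rate r (A : R) : R := (4 * r`!%:R * A + 2)^-1.

Lemma multiindices_le_n s a r A (p : R) n : (0 < r)%N -> 1 < p ->
  (p - 1) * r%:R <= 1 -> (forall j, 0 < a j) -> 0 <= A ->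
  \sum_(j < s) (a j ^+ r)^-1 <= A -> 1 <= ln (n%:R : R) ->
  exists l : seq (seq nat),
    (forall al, size al = s -> weight a al < rate r A * (ln n%:R) `^ p -> al \in l) /\
    (size l <= n)%N.
Proof.
move=> r0 p1 pr a0 A0 hA; set X := ln _ => X1.
have X0 : 0 < X by exact: lt_le_trans X1.
have n0 : (0 < n)%N by rewrite lt0n; apply/eqP => n0; move: X1; rewrite /X n0 ln0// ler10.
set k := rate r A.
have d0 : 0 < 4 * r`!%:R * A + 2 by rewrite ltr_wpDl// !mulr_ge0.
have k0 : 0 < k by rewrite invr_gt0.
have k1 : 2 * k <= 1.
  by rewrite /k /rate ler_pdivrMr// mul1r lerDr !mulr_ge0.
have kA : r`!%:R * A * (2 * k) <= 1 / 2.
  rewrite /k /rate mulrA ler_pdivrMr//; lra.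
have Xp0 : 0 < X `^ p by rewrite powR_gt0.
set L := k * X `^ p; have L0 : 0 < L by rewrite mulr_gt0.
(* With this d the factor e^(d L) is the square root of n; the product has to stay below the other
   square root. *)
pose d := X / (2 * L); have dd0 : 0 < d by rewrite divr_gt0// mulr_gt0.
have [l [hl sl]] := multiindices_below s L a0 dd0.
exists l; split => //; rewrite -(ler_nat R) (le_trans sl)//.
have -> : d * L = X / 2 by rewrite /d; field; rewrite gt_eqF.
(* Here 1/d = 2 k X^(p-1); its r-th power is at most 2 k X because 2 k <= 1, X >= 1 and (p - 1) r <=
   1. *)
have hd : (d ^+ r)^-1 <= 2 * k * X.
  rewrite /d expr_div_n invfM invrK mulrC -expr_div_n.
  rewrite (_ : 2 * L / X = 2 * k * X `^ (p - 1)); last first.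
    rewrite powRD; last by rewrite (gt_eqF X0) implybT.
    by rewrite powRN powRr1 ?ltW// /L; ring.
  rewrite exprMn ler_pM ?exprn_ge0 ?powR_ge0 ?mulr_ge0 ?(ltW k0)//.
    by rewrite -[leRHS]expr1 ler_wiXn2l// mulr_ge0// ltW.
  by rewrite -powR_mulrn ?powR_ge0// -powRrM -[leRHS]powRr1 ?ler_powR// ltW.
apply: (@le_trans _ _ (expR (X / 2) * \prod_(j < s)
    expR (r`!%:R * (2 * k * X) * (a j ^+ r)^-1))).
  rewrite ler_wpM2l ?expR_ge0//; apply: ler_prod => j _.
  have da0 : 0 < d * a j by rewrite mulr_gt0.
  rewrite invr_ge0 subr_ge0 (ltW (_ : _ < 1)) ?expR_lt1 ?oppr_lt0//=.
  apply: (le_trans (inv_1BexpR_le da0 r0)).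
  rewrite ler_expR exprMn invfM [leLHS]mulrA; apply: ler_wpM2r.
    by rewrite invr_ge0 exprn_ge0// ltW.
  by rewrite ler_wpM2l.
rewrite -expR_sum -expRD -(@lnK _ n%:R) ?posrE ?ltr0n// ler_expR -/X -mulr_sumr.
have : r`!%:R * (2 * k * X) * \sum_(j < s) (a j ^+ r)^-1 <= r`!%:R * (2 * k * X) * A.
  by rewrite ler_wpM2l// !mulr_ge0// ltW.
have : r`!%:R * A * (2 * k) * X <= 1 / 2 * X by rewrite ler_wpM2r// ltW.
lra.
Qed.
End counting.

(** * Smooth functions on the cube *)

Section smooth_functions.
Context {R : realType}.
Local Notation RR := (measurableTypeR R).

(** Missing coordinates are filled with 0, so that every list yields a point. *)
Definition row_of_seq s (x : seq R) : 'rV[R]_s := \row_i nth 0 x i.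

Lemma row_of_seq_tuple s (t : s.-tuple RR) : row_of_seq s t = row_of_tuple t.
Proof. by apply/rowP => i; rewrite !mxE (tnth_nth 0). Qed.

Lemma unit_cube_row s (x : seq R) : size x = s ->
  unit_cube (row_of_seq s x) <-> all in01 x.
Proof.
move=> sx; split => [h|/allP h i].
  apply/(all_nthP 0) => i; rewrite sx => si.
  by have := h (Ordinal si); rewrite mxE.
by rewrite mxE; apply: h; rewrite mem_nth// sx.
Qed.

Lemma cube_unit_cube s (t : s.-tuple RR) : cube t <-> unit_cube (row_of_tuple t).
Proof.
rewrite -row_of_seq_tuple; split => [h|].
  by apply/unit_cube_row => //; rewrite size_tuple.
by move=> h; apply/(unit_cube_row _).1 => //; rewrite size_tuple.
Qed.

(** This rounds x down to the grid of mesh 1/(m+1); the index m + 1 is reached at x = 1. *)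
Lemma truncn_div_in01 (m : nat) (x : R) : in01 x ->
  let k := Num.truncn (m.+1%:R * x) in
  [/\ (k < m.+2)%N, in01 (k%:R / m.+1%:R : R), k%:R / m.+1%:R <= x &
      x < k.+1%:R / m.+1%:R].
Proof.
move=> /andP[x0 x1] k.
have m0 : 0 < m.+1%:R :> R by rewrite ltr0n.
have y0 : 0 <= m.+1%:R * x by rewrite mulr_ge0.
have k1 : k%:R <= m.+1%:R * x by rewrite truncn_le.
have k2 : m.+1%:R * x < k.+1%:R by exact: truncnS_gt.
have k3 : k%:R / m.+1%:R <= x by rewrite ler_pdivrMr// mulrC.
split => //.
- by rewrite ltnS -(ler_nat R) (le_trans k1)// ler_piMr.
- by rewrite /in01 divr_ge0//= (le_trans k3).
- by rewrite ltr_pdivlMr// mulrC.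
Qed.

(** The topology lives on row vectors and the sigma-algebra on tuples. The two are linked by writing
    g as the pointwise limit of its values at points rounded down to a grid. *)
Lemma measurable_unit_cube s (g : 'rV[R]_s -> R) :
  {within @unit_cube R s, continuous g} ->
  measurable_fun (@cube R s) (fun t => g (row_of_tuple t)).
Proof.
move=> cg.
pose rnd m (t : s.-tuple RR) : 'rV[R]_s :=
  \row_i ((Num.truncn (m.+1%:R * tnth t i))%:R / m.+1%:R).
apply: (@measurable_fun_cvg _ _ _ _ (fun m t => g (rnd m t))).
  move=> m mD Y mY.
  (* On each of these finitely many grid cells the rounded point is constant, so a preimage is a
     finite union of cells within the cube. *)
  pose A (k : {ffun 'I_s -> 'I_m.+2}) := \big[setI/setT]_(i < s)
    ((fun t : s.-tuple RR => tnth t i) @^-1`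
      (`[(k i)%:R / m.+1%:R, (k i).+1%:R / m.+1%:R[%classic : set RR)).
  have m0 : 0 < m.+1%:R :> R by rewrite ltr0n.
  have AE k t : cube t -> A k t -> rnd m t = \row_i ((k i)%:R / m.+1%:R).
    move=> /all_tnthP ht; rewrite /A -bigcap_seq => hA; apply/rowP => i; rewrite !mxE.
    have := hA i; rewrite /= mem_index_enum in_itv/= => /(_ isT).
    rewrite ler_pdivrMr// ltr_pdivlMr// mulrC => h.
    congr (_%:R / _); apply/eqP; rewrite truncn_eq ?h//.
    by rewrite mulr_ge0//; have /andP[] := ht i.
  rewrite (_ : _ `&` _ = \big[setU/set0]_(k : {ffun 'I_s -> 'I_m.+2} | g (\row_i ((k i)%:R / m.+1%:R)) \in Y)
    (@cube R s `&` A k)); last first.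
    rewrite -bigcup_seq_cond; apply/seteqP; split => [t [ht hY]|t [k]].
      have /all_tnthP ht' := ht.
      pose k := [ffun i : 'I_s => inord (Num.truncn (m.+1%:R * tnth t i)) : 'I_m.+2].
      have kE i : nat_of_ord (k i) = Num.truncn (m.+1%:R * tnth t i).
        by rewrite ffunE inordK//; have [] := truncn_div_in01 m (ht' i).
      have hA : A k t.
        rewrite /A -bigcap_seq => i _; rewrite /= in_itv/= kE.
        by have [_ _ -> ->] := truncn_div_in01 m (ht' i).
      exists k; last by split.
      by rewrite /= mem_index_enum/= -(AE _ _ ht hA) inE.
    by rewrite /= mem_index_enum/= inE => hY [ht hA]; split => //=; rewrite (AE k).
  apply: bigsetU_measurable => k _; apply: measurableI => //.
  apply: bigsetI_measurable => i _; rewrite -[X in measurable X]setTI.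
  exact: measurable_tnth.
move=> t ht; have /all_tnthP ht' := ht.
have rc m : unit_cube (rnd m t).
  by move=> i; rewrite mxE; have [] := truncn_div_in01 m (ht' i).
have := (subspace_continuousP _ _).1 cg _ ((cube_unit_cube t).1 ht).
apply: cvg_trans; apply: cvg_comp; last exact: cvg_id.
move=> P; rewrite /within/= => /nbhs_ballP[e/= e0 hP].
near=> m; apply: hP => //.
have em : m.+1%:R^-1 < e.
  near: m; exact: near_infty_natSinv_lt (PosNum e0).
split => // i j; rewrite ord1 !mxE /ball/=.
have [_ _ h1 h2] := truncn_div_in01 m (ht' j).
rewrite ger0_norm ?subr_ge0//.
have : tnth t j - (Num.truncn (m.+1%:R * tnth t j))%:R / m.+1%:R < m.+1%:R^-1; last first.
  by move=> h; exact: lt_trans h em.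
by rewrite ltrBlDl -[X in _ + X]mul1r -mulrDl natr1.
Unshelve. all: by end_near. Qed.

(** This turns iterated partial derivatives into a single list of directions, the form over which
    [smooth_cube] quantifies. *)
Lemma foldr_iter (T A : Type) (op : T -> A -> A) (al : T -> nat) f l :
  foldr (fun i g => iter (al i) (op i) g) f l =
  foldr op f (flatten [seq nseq (al i) i | i <- l]).
Proof.
elim: l => //= i l ->; rewrite foldr_cat.
by elim: (al i) => //= n ->.
Qed.

Lemma mixed_partial_foldr s (al : 'I_s -> nat) f :
  mixed_partial al f =
  foldr (@partial R s) f (flatten [seq nseq (al i) i | i <- enum 'I_s]).
Proof. exact: foldr_iter. Qed.

(** [mixed_partial] applies the lower directions last. When their orders vanish, a further
    derivative in direction i is already in its place and nothing is interchanged. *)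
Lemma partial_mixed_partial s (i : 'I_s) (al : 'I_s -> nat) (f : 'rV[R]_s -> R) :
  (forall j : 'I_s, (j < i)%N -> al j = 0%N) ->
  partial i (mixed_partial al f) = mixed_partial (fun j => (j == i) + al j)%N f.
Proof.
move=> al0; rewrite /mixed_partial.
have [e1 [e2 [-> h1 h2]]] : exists e1 e2, [/\ enum 'I_s = e1 ++ i :: e2,
    (forall j, j \in e1 -> (j < i)%N) & (forall j, j \in e2 -> (i < j)%N)].
  exists (take i (enum 'I_s)), (drop i.+1 (enum 'I_s)); split.
  - by rewrite -[in LHS](cat_take_drop i (enum 'I_s)) (drop_nth i) ?size_enum_ord// nth_ord_enum.
  - move=> j /(map_f val); rewrite map_take val_enum_ord take_iota.
    by rewrite mem_iota/= add0n => /leq_trans; apply; exact: geq_minl.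
  - move=> j /(map_f val); rewrite map_drop val_enum_ord drop_iota mem_iota.
    by case/andP.
rewrite !foldr_cat /= eqxx add1n iterS.
have idf g b : (forall j, j \in e1 -> b j = 0%N) ->
    foldr (fun j g => iter (b j) (@partial R s j) g) g e1 = g.
  elim: e1 {h1} => //= j e1 IH hb.
  by rewrite (hb j) ?mem_head// IH// => j' h; apply: hb; rewrite inE h orbT.
rewrite !idf; last 2 first.
- by move=> j /h1 ji; rewrite al0// addn0; case: eqP ji => // ->; rewrite ltnn.
- by move=> j /h1; exact: al0.
congr (partial i (iter _ _ _)).
elim: e2 h2 => //= j e2 IH h2; rewrite IH; last first.
  by move=> j' h; apply: h2; rewrite inE h orbT.
have := h2 j (mem_head _ _); case: eqP => // ->; by rewrite ltnn.
Qed.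

Definition smooth_jet s (f : 'rV[R]_s -> R) (al : seq nat) (x : seq R) : R :=
  mixed_partial (fun i : 'I_s => nth 0%N al i) f (row_of_seq s x).

Lemma jet_smooth s (f : 'rV[R]_s -> R) : smooth_cube f -> jet s (smooth_jet f).
Proof.
move=> sf; split => [al sal|i k be x y his sx sy x01 y01 z z01].
  have [cg _] := sf (flatten [seq nseq (nth 0%N al (i : 'I_s)) i | i <- enum 'I_s]).
  apply: eq_measurable_fun (measurable_unit_cube cg) => t _.
  by rewrite /smooth_jet mixed_partial_foldr row_of_seq_tuple.
have hi : (i < s)%N by rewrite -his addnS ltnS leq_addr.
pose o := Ordinal hi.
set al := nseq i 0%N ++ k :: be.
have rowE h : row_of_seq s (x ++ (z + h) :: y) =
    row_of_seq s (x ++ z :: y) + h *: delta_mx 0 o.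
  apply/rowP => j; rewrite !mxE eqxx /= !nth_cat sx.
  rewrite -(inj_eq val_inj) /=; case: ltnP => ji.
    by rewrite (ltn_eqF ji) mulr0 addr0.
  have [->|ji'] := eqVneq (j : nat) i; first by rewrite subnn mulr1.
  rewrite mulr0 addr0; have : (0 < j - i)%N by rewrite subn_gt0 ltn_neqAle eq_sym ji'.
  by case: (j - i)%N.
have e : smooth_jet f (nseq i 0%N ++ k.+1 :: be) (x ++ z :: y) =
    partial o (mixed_partial (fun j : 'I_s => nth 0%N al j) f) (row_of_seq s (x ++ z :: y)).
  rewrite partial_mixed_partial; last first.
    by move=> j /= ji; rewrite /al nth_cat size_nseq ji nth_nseq ji.
  rewrite /smooth_jet; congr (mixed_partial _ f _).
  apply/funext => j; rewrite /al !nth_cat size_nseq -(inj_eq val_inj)/=.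
  case: ltnP => ji; first by rewrite (ltn_eqF ji).
  have [->|ji'] := eqVneq (j : nat) i; first by rewrite subnn.
  have : (0 < j - i)%N by rewrite subn_gt0 ltn_neqAle eq_sym ji'.
  by case: (j - i)%N.
rewrite e.
have [_ /(_ o (row_of_seq s (x ++ z :: y)))] :=
  sf (flatten [seq nseq (nth 0%N al (i : 'I_s)) i | i <- enum 'I_s]).
have sz w : size (x ++ w :: y) = s by rewrite size_cat /= sx sy.
rewrite -mixed_partial_foldr.
have : unit_cube (row_of_seq s (x ++ z :: y)).
  by apply/unit_cube_row => //; rewrite all_cat/= x01 y01 andbT.
move=> cz /(_ cz); rewrite /partial_exists -/(partial _ _ _) /increments.
(* The other coordinates already lie in [0,1], so an increment stays in the cube exactly when the
   moved coordinate stays in [0,1]. *)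
rewrite (_ : [set h | _] = [set h | 0 <= z + h <= 1]); last first.
  apply/seteqP; split => h /=; rewrite -rowE.
    by move/(unit_cube_row (sz _)); rewrite all_cat/= => /and3P[].
  by move=> zh; apply/(unit_cube_row (sz _)); rewrite all_cat/= x01 y01 andbT.
rewrite (_ : diff_quotient _ _ _ = fun h => h^-1 *
  (smooth_jet f al (x ++ (z + h) :: y) - smooth_jet f al (x ++ z :: y)))//.
by apply/funext => h; rewrite /diff_quotient -rowE.
Qed.

End smooth_functions.

(** * From the pointwise bound to the minimal error *)

Section minimal_error_bound.
Context {R : realType}.
Local Notation RR := (measurableTypeR R).
Local Notation lam := (@lebesgue_tuple R).
Implicit Types (u a C : nat -> R).

Lemma cubeL1_smooth s (f : 'rV[R]_s -> R) al :
  cubeL1 s (smooth_jet f al) = L1norm (mixed_partial (fun i : 'I_s => nth 0%N al i) f).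
Proof.
rewrite /cubeL1 /L1norm.
rewrite (_ : @row_of_tuple R s @^-1` _ = @cube R s); last first.
  by apply/seteqP; split => t; [move/(cube_unit_cube t).2|move/(cube_unit_cube t).1].
by apply: eq_integral => t _; rewrite /smooth_jet row_of_seq_tuple.
Qed.

Lemma smooth_jet0 s (f : 'rV[R]_s -> R) x :
  smooth_jet f (nseq s 0%N) x = f (row_of_seq s x).
Proof.
rewrite /smooth_jet /mixed_partial.
elim: (enum 'I_s) => //= i e IH.
by rewrite nth_nseq if_same.
Qed.

Lemma cubeL1_Fnorm s u (f : 'rV[R]_s -> R) al : (forall j, 0 < u j.+1) ->
  (Fnorm u f <= 1)%E -> size al = s ->
  (cubeL1 s (smooth_jet f al) <= (monom (fun j => u j.+1) al)%:E)%E.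
Proof.
move=> u0 nf sal; rewrite cubeL1_smooth /monom sal.
have P0 : 0 < \prod_(j < s) u j.+1 ^+ nth 0%N al j.
  by apply: prodr_gt0 => j _; rewrite exprn_gt0.
rewrite -[leRHS]mul1e -lee_pdivrMr//.
apply: le_trans nf; apply: ereal_sup_ubound.
by exists (fun i : 'I_s => nth 0%N al i).
Qed.

Lemma measurable_half_open_cube s :
  measurable (@row_of_tuple R s @^-1` @half_open_cube R s).
Proof.
rewrite (_ : _ @^-1` _ = \big[setI/setT]_(i < s) ((fun t => tnth t i) @^-1`
   (`[0, 1[%classic : set RR))).
  apply: bigsetI_measurable => i _; rewrite -[X in measurable X]setTI.
  exact: measurable_tnth.
rewrite -bigcap_seq; apply/seteqP; split => [t h i _|t h i].
  by rewrite /= in_itv/=; have := h i; rewrite mxE.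
by have := h i; rewrite /= in_itv/= mxE; apply; rewrite mem_index_enum.
Qed.

Lemma half_open_cube_sub s : @row_of_tuple R s @^-1` @half_open_cube R s `<=` @cube R s.
Proof.
move=> t h; apply/(cube_unit_cube t).2 => i.
by have /andP[-> /ltW] := h i.
Qed.

(** The norm bound at order 0 controls the L1 norm of f itself. *)
Lemma integrable_smooth s u (f : 'rV[R]_s -> R) : (forall j, 0 < u j.+1) ->
  smooth_cube f -> (Fnorm u f <= 1)%E ->
  (lam s).-integrable (@row_of_tuple R s @^-1` @half_open_cube R s)
     (EFin \o (fun t => f (row_of_tuple t))).
Proof.
move=> u0 sf nf.
apply: (integrableS (@measurable_cube R s)) => //.
- exact: measurable_half_open_cube.
- exact: half_open_cube_sub.
have e t : smooth_jet f (nseq s 0%N) (tval t) = f (row_of_tuple t).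
  by rewrite smooth_jet0 row_of_seq_tuple.
apply/integrableP; split.
  apply/measurable_EFinP.
  apply: eq_measurable_fun ((jet_smooth sf).1 (nseq s 0%N) (size_nseq _ _)) => t _.
  exact: e.
apply: le_lt_trans (ltry (monom (fun j => u j.+1) (nseq s 0%N))).
have := cubeL1_Fnorm u0 nf (size_nseq s 0%N); apply: le_trans.
rewrite /cubeL1 le_eqVlt; apply/orP; left; apply/eqP.
by apply: eq_integral => t _; rewrite e.
Qed.

Lemma cube_integral_diff s u (f g : 'rV[R]_s -> R) M : (forall j, 0 < u j.+1) ->
  smooth_cube f -> (Fnorm u f <= 1)%E -> smooth_cube g -> (Fnorm u g <= 1)%E ->
  (forall x, size x = s -> all in01 x ->
    `|f (row_of_seq s x) - g (row_of_seq s x)| <= M) ->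
  `|cube_integral f - cube_integral g| <= M.
Proof.
move=> u0 sf nf sg ng h.
have fi := integrable_smooth u0 sf nf; have gi := integrable_smooth u0 sg ng.
have mH := @measurable_half_open_cube s.
have fgi : (lam s).-integrable (@row_of_tuple R s @^-1` @half_open_cube R s)
     (EFin \o (fun t => f (row_of_tuple t) - g (row_of_tuple t))).
  by move: (integrableB mH fi gi); apply: eq_integrable.
rewrite /cube_integral -RintegralB// -lee_fin EFin_normr_Rintegral//.
have /integrableP[mfg _] := fgi.
apply: (le_trans (le_abse_integral _ mH mfg)).
have M0 : 0 <= M.
  apply: le_trans (h (nseq s 0) (size_nseq _ _) _) => //.
  by apply/allP => x /nseqP[-> _]; rewrite /in01 lexx ler01.
apply: (@le_trans _ _ (\int[lam s]_(t in @row_of_tuple R s @^-1` @half_open_cube R s) M%:E)%E).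
  apply: ge0_le_integral => //; first exact: measurableT_comp.
  move=> t ht; rewrite /= lee_fin -row_of_seq_tuple; apply: h; first by rewrite size_tuple.
  exact: half_open_cube_sub ht.
rewrite integral_cst// -[leRHS]mule1 lee_wpmul2l//.
rewrite -(cube_volume (R:=R) s); apply: le_measure; rewrite ?inE//.
- exact: measurable_cube.
- exact: half_open_cube_sub.
Qed.

Lemma F_minimal_error_le s n u a C (L : R) (l : seq (seq nat)) :
  (forall j, 0 < u j.+1) -> (forall j, 0 < a j) ->
  (forall j k, u j.+1 ^+ k / k`!%:R <= C j * expR (- (a j * k%:R))) ->
  (forall al, size al = s -> weight a al < L -> al \in l) -> (size l <= n)%N ->
  (F_minimal_error n s u <=
    (2 * expR (- L / 2) * err_const (fun j => u j.+1) a C s)%:E)%E.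
Proof.
move=> u0 a0 uC hl ln.
(* Indices k beyond the end of [l] sample at the origin, by the default values. *)
pose t (k : 'I_n) := row_of_seq s [seq node (R := R) m | m <- nth [::] l k].
pose ball (f : 'rV[R]_s -> R) := Fspace u f /\ (Fnorm u f <= 1)%E.
have ht k : half_open_cube (t k).
  move=> i; rewrite mxE; set al := nth [::] l k.
  have [ia|ia] := ltnP i (size al).
    by rewrite (nth_map 0%N)// node_lt1 ltW// node_gt0.
  by rewrite nth_default ?size_map// lexx ltr01.
(* On data coming from the unit ball, [phi] returns the integral of some function of the ball with
   these data; otherwise it returns 0. *)
have /choice[phi hphi] : forall y : 'rV[R]_n, exists v : R,
    (exists2 f, ball f & (\row_k f (t k)) = y) ->
    exists f, [/\ ball f, (\row_k f (t k)) = y & v = cube_integral f].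
  move=> y; have [[f bf fy]|h] := pselect (exists2 f, ball f & (\row_k f (t k)) = y).
    by exists (cube_integral f) => _; exists f.
  by exists 0 => /h.
apply: ge_ereal_inf; exists (worst_case_error (@Fspace R s u) (@Fnorm R s u) (algorithm t phi)).
  by exists t, phi.
apply: ge_ereal_sup => _ [f [Ff nf] <-]; rewrite /algorithm.
have [|g [[Fg ng] gy ->]] := hphi (\row_k f (t k)); first by exists f.
have [sf _] := Ff; have [sg _] := Fg.
rewrite lee_fin; apply: (cube_integral_diff u0 sf nf sg ng) => x sx x01.
(* The bound is applied to f - g with B = 2, both functions having norm at most 1. *)
have := @jet_bound R s (fun j => u j.+1) a C _ 2 L x (fun j => ltW (u0 j)) a0 uC _
  (jet_lin 1 (-1) (jet_smooth sf) (jet_smooth sg)) _ _ sx x01.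
rewrite !smooth_jet0 mul1r mulN1r; apply => //.
- move=> al sal.
  have mF := (jet_smooth sf).1 al sal; have mG := (jet_smooth sg).1 al sal.
  have hF := cubeL1_Fnorm u0 nf sal; have hG := cubeL1_Fnorm u0 ng sal.
  rewrite mulrDl mul1r EFinD; apply: le_trans (leeD hF hG).
  rewrite /cubeL1 -ge0_integralD//; last 3 first.
  - exact: measurable_cube.
  - exact/measurable_EFinP/measurableT_comp.
  - exact/measurable_EFinP/measurableT_comp.
  apply: ge0_le_integral => //.
  - exact: measurable_cube.
  - apply/measurable_EFinP/measurableT_comp => //.
    exact: ((jet_lin 1 (-1) (jet_smooth sf) (jet_smooth sg)).1 al sal).
  - by apply: emeasurable_funD; apply/measurable_EFinP/measurableT_comp.
  - by move=> z _; rewrite mul1r mulN1r -EFinD lee_fin ler_normB.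
move=> al sal w; have al_l := hl al sal w.
have kn : (index al l < n)%N by rewrite (leq_trans _ ln)// index_mem.
move/rowP: gy => /(_ (Ordinal kn)); rewrite !mxE /t /= nth_index// => e.
by rewrite !smooth_jet0 mul1r mulN1r e subrr.
Qed.

End minimal_error_bound.

(** * Rates of convergence *)

Section rates.
Context {R : realType}.
Implicit Types (u a c : nat -> R).

Lemma exprn_fact_le_expR (x : R) k : 0 <= x -> x ^+ k / k`!%:R <= expR x.
Proof.
move=> x0; case: k => [|k]; first by rewrite expr0 fact0 divr1 -expR0 ler_expR.
by rewrite (le_trans _ (expR_ge1Dxn k x0))// lerDr.
Qed.

(** x^k e^(y k) / k! is a term of the series of exp at x e^y; any rate y is allowed, at the price of
    the constant. *)
Lemma exprn_fact_le_geom (x y : R) k : 0 <= x ->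
  x ^+ k / k`!%:R <= expR (x * expR y) * expR (- (y * k%:R)).
Proof.
move=> x0; rewrite expRN -ler_pdivrMr ?invr_gt0 ?expR_gt0// invrK.
rewrite [y * _]mulrC expRM_natl mulrAC -exprMn.
by apply: exprn_fact_le_expR; rewrite mulr_ge0 ?expR_ge0.
Qed.

(** The last factor covers the n with ln n < 1. *)
Definition error_factor r (A : R) : R :=
  2 * expR (r`!%:R * 2 ^+ r * A) * expR (rate r A / 2).

Lemma F_minimal_error_decay s u a c r (A p : R) n :
  (0 < r)%N -> 1 < p -> (p - 1) * r%:R <= 1 ->
  (forall j, 0 < u j.+1) -> (forall j, 0 < a j) -> (forall j, 0 <= c j) ->
  (forall j k, u j.+1 ^+ k / k`!%:R <= expR (c j) * expR (- (a j * k%:R))) ->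
  \sum_(j < s) (u j.+1 + c j + (a j ^+ r)^-1) <= A -> (0 < n)%N ->
  (F_minimal_error n s u <=
    (error_factor r A * expR (- (rate r A / 2) * (ln n%:R) `^ p))%:E)%E.
Proof.
move=> r0 p1 pr u0 a0 c0 uC hA n0.
have sa : \sum_(j < s) (a j ^+ r)^-1 <= A.
  by apply: le_trans hA; apply: ler_sum => j _; rewrite lerDr addr_ge0 ?c0// ltW.
have A0 : 0 <= A.
  apply: le_trans sa; apply: sumr_ge0 => j _.
  by rewrite invr_ge0 exprn_ge0// ltW.
have k0 : 0 < rate r A by rewrite invr_gt0 ltr_wpDl// !mulr_ge0.
have hP := err_const_le r0 (fun j => ltW (u0 j)) a0 c0 hA.
have E0 : 0 <= 2 * expR (r`!%:R * 2 ^+ r * A) by rewrite mulr_ge0 ?expR_ge0.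
have X0 : 0 <= ln (n%:R : R) by rewrite ln_ge0// ler1n.
have [X1|X1] := lerP 1 (ln (n%:R : R)).
  have [l [hl ln_l]] := multiindices_le_n r0 p1 pr a0 A0 sa X1.
  apply: (le_trans (F_minimal_error_le u0 a0 uC hl ln_l)).
  rewrite lee_fin /error_factor.
  rewrite (_ : - (rate r A * _) / 2 = - (rate r A / 2) * (ln n%:R) `^ p); last by ring.
  rewrite mulrAC ler_wpM2r ?expR_ge0//.
  apply: (@le_trans _ _ (2 * expR (r`!%:R * 2 ^+ r * A))); first by rewrite ler_wpM2l.
  by rewrite ler_peMr// -[leLHS]expR0 ler_expR divr_ge0// ltW.
(* For ln n < 1 the level L = 0 and the empty list give a bound without decay; as (ln n)^p <= 1, the
   last factor of [error_factor] makes up for the claimed decay. *)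
apply: (le_trans (@F_minimal_error_le _ s n u a _ 0 [::] u0 a0 uC _ _)) => //.
  by move=> al _ /lt_le_trans/(_ (weight_ge0 al a0)); rewrite ltxx.
rewrite lee_fin oppr0 mul0r expR0 mulr1 /error_factor -mulrA -expRD.
apply: (@le_trans _ _ (2 * expR (r`!%:R * 2 ^+ r * A))); first by rewrite ler_wpM2l.
rewrite ler_peMr// -[leLHS]expR0 ler_expR mulNr subr_ge0 ler_piMr ?divr_ge0 ?(ltW k0)//.
apply: (@le_trans _ _ (1 `^ p)); last by rewrite powR1.
by rewrite ge0_ler_powR ?nnegrE ?ler01 ?(ltW X1) ?(ltW (lt_trans ltr01 p1)).
Qed.

(* Telescoping: with e = t - 1, x^(-t) <= (2 + e) / e * (x^(-e) - (x + 1)^(-e)) for x >= 1. *)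
Lemma sum_powR_bounded (t : R) : 1 < t -> exists Z : R, forall s,
  \sum_(j < s) (j.+1%:R `^ t)^-1 <= Z.
Proof.
move=> t1; set e := t - 1; have e0 : 0 < e by rewrite subr_gt0.
pose W := (2 + e) / e; have W0 : 0 <= W by apply: divr_ge0; lra.
exists W => s.
suff : \sum_(j < s) (j.+1%:R `^ t)^-1 <= W * (1 - (s.+1%:R `^ e)^-1).
  by move/le_trans; apply; rewrite ler_piMr.
elim: s => [|s IH]; first by rewrite big_ord0 powR1 invr1 subrr mulr0.
rewrite big_ord_recr/=; apply: (le_trans (lerD IH (lexx _))).
set x : R := s.+1%:R; have x1 : 1 <= x by rewrite ler1n.
have x0 : 0 < x by exact: lt_le_trans x1.
have -> : s.+2%:R = x + 1 :> R by rewrite /x -natr1.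
have xe0 : 0 < x `^ e by rewrite powR_gt0.
have xE : x `^ t = x * x `^ e.
  have -> : t = 1 + e by rewrite addrC subrK.
  by rewrite powRD ?(gt_eqF x0) ?implybT// powRr1// ltW.
(* This comes from e^v >= 1 + v and ln(1 + 1/x) = - ln(1 - 1/(x+1)) >= 1/(x+1). *)
have h : x `^ e * (1 + e / (x + 1)) <= (x + 1) `^ e.
  have q0 : 0 < (x + 1) / x by apply: divr_gt0; lra.
  have -> : (x + 1) `^ e = x `^ e * ((x + 1) / x) `^ e.
    by rewrite -powRM ?(ltW x0) ?(ltW q0)// mulrC divfK// gt_eqF.
  apply: ler_wpM2l; first exact: ltW.
  rewrite /powR (gt_eqF q0).
  apply: le_trans (expR_ge1Dx _); rewrite lerD2l; apply: ler_wpM2l; first exact: ltW.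
  have q1 : 0 < x / (x + 1) by apply: divr_gt0; lra.
  rewrite -[(x + 1) / x]invf_div lnV ?posrE// lerNr.
  rewrite (_ : x / (x + 1) = 1 + - (x + 1)^-1); last first.
    by field; rewrite gt_eqF// addr_gt0.
  rewrite le_ln1Dx// ltrNl opprK invf_lt1 ?addr_gt0//; lra.
have xp0 : 0 < x + 1 by rewrite addr_gt0.
have y0 : 0 < 1 + e / (x + 1) by rewrite addr_gt0// divr_gt0.
have h' : ((x + 1) `^ e)^-1 <= (x `^ e)^-1 * (1 + e / (x + 1))^-1.
  by rewrite -invfM lef_pV2 ?posrE ?mulr_gt0 ?powR_gt0.
rewrite xE invfM.
set y := (x `^ e)^-1 in h' *; have y00 : 0 < y by rewrite invr_gt0.
set z := ((x + 1) `^ e)^-1 in h' *.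
have {}h' : W * z <= W * (y * (1 + e / (x + 1))^-1) by rewrite ler_wpM2l.
suff : x^-1 * y <= W * y - W * (y * (1 + e / (x + 1))^-1).
  by move: h'; move: W (y / _) z x^-1 {W0 IH} => w1 v z1 x2; lra.
rewrite -subr_ge0 [leRHS](_ : _ = y * ((2 + e) / (x + 1 + e) - x^-1)); last first.
  rewrite /W; field; rewrite !gt_eqF//; lra.
apply: mulr_ge0; first exact: ltW.
have w0 : 0 < x + 1 + e by rewrite addr_gt0.
rewrite subr_ge0 ler_pdivlMr// mulrC ler_pdivrMr//.
have : 0 <= (1 + e) * (x - 1) by rewrite mulr_ge0 ?subr_ge0// addr_ge0// ltW.
by lra.
Qed.

Lemma limn_einf_gt0_expR_decay u (q : R) : 0 < q -> (forall j, (0 < j)%N -> 0 < u j) ->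
  (0 < limn_einf (fun j : nat => (ln ((u j)^-1) / (j%:R `^ q))%:E))%E ->
  exists c : R, exists J : nat, 0 < c /\
    forall j, (J <= j.+1)%N -> u j.+1 <= expR (- (c * j.+1%:R `^ q)).
Proof.
move=> q0 u0; set v := fun _ => _; rewrite limn_einf_lim.
rewrite (cvg_lim _ (@cvg_einfs_sup R v))// => /ereal_sup_gt[_ [J _ <-] hJ].
(* Some tail infimum is positive; if it is infinite, c = 1 serves. *)
have [c [c0 cJ]] : exists c : R, 0 < c /\ (c%:E <= einfs v J)%E.
  case E : (einfs v J) hJ => [c| |] //; last by exists 1; rewrite ltr01 leey.
  by rewrite lte_fin => c0; exists c.
exists c, J; split => // j Jj.
have h : (c%:E <= v j.+1)%E.
  by apply: le_trans cJ _; apply: ereal_inf_lbound; exists j.+1.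
have uj := u0 j.+1 isT.
move: h; rewrite /v lee_fin ler_pdivlMr ?powR_gt0// lnV// => h.
by rewrite -[leLHS](@lnK _ (u j.+1))// ler_expR lerNr.
Qed.

End rates.

(** * Choice of the parameters in fixed and in arbitrary dimension *)

Unset Implicit Arguments.

Theorem theorem4p2 (R : realType) (u : nat -> R)
    (u_pos : forall j : nat, (0 < j)%N -> 0 < u j)
    (u_noninc : forall j : nat, (0 < j)%N -> u j.+1 <= u j) :
  (forall s : nat, (0 < s)%N ->
     exists c5 c6 : R, 0 < c5 /\ 0 < c6 /\
       forall n : nat, (0 < n)%N ->
         (F_minimal_error n s u
            <= (c5 * expR (- c6 * (ln (n%:R : R)) ^+ 2))%:E)%E) /\
  (forall p : R, 1 < p < 2 ->
     (0 < limn_einf (fun j : nat =>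
            (ln ((u j)^-1) / (j%:R `^ ((p - 1) / (2 - p))))%:E))%E ->
     exists C c : R, 0 <= C /\ 0 < c /\
       forall s n : nat, (0 < s)%N -> (0 < n)%N ->
         (F_minimal_error n s u
            <= (C * expR (- c * ((ln (n%:R : R)) `^ p)))%:E)%E).
Proof.
have u0 j : 0 < u j.+1 by exact: u_pos.
have factor0 r (A : R) : 0 < error_factor r A by rewrite !mulr_gt0 ?expR_gt0.
have rate0 r (A : R) : 0 <= A -> 0 < rate r A / 2.
  by move=> A0; rewrite divr_gt0// invr_gt0 ltr_wpDl// !mulr_ge0.
split=> [s s0|p /andP[p1 p2] hu].
  (* The constants of [exprn_fact_le_geom] at rate a_j = 1; A may depend on s here. *)
  pose c j := u j.+1 * expR 1.
  have c0 j : 0 <= c j by rewrite mulr_ge0 ?expR_ge0 ?ltW.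
  pose A := \sum_(j < s) (u j.+1 + c j + ((1 : R) ^+ 1)^-1).
  have A0 : 0 <= A.
    by apply: sumr_ge0 => j _; rewrite expr1n invr1 !addr_ge0// ltW.
  exists (error_factor 1 A), (rate 1 A / 2); split => //; split; first exact: rate0.
  move=> n n0; rewrite -powR_mulrn ?ln_ge0 ?ler1n//.
  apply: (@F_minimal_error_decay _ s u (fun=> 1) c) => //.
  - by rewrite ltr1n.
  - by move=> j k; apply: exprn_fact_le_geom; exact: ltW.
set q := (p - 1) / (2 - p) in hu.
have q0 : 0 < q by rewrite divr_gt0 ?subr_gt0.
have [b [J [b0 hb]]] := limn_einf_gt0_expR_decay q0 u_pos hu.
(* The largest r with (p - 1) r <= 1. Since 1/q = 1/(p - 1) - 1 < r, also q r > 1, so the sum of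
   (j+1)^(-q r) is bounded. *)
set r := Num.truncn (p - 1)^-1.
have pp : 0 < p - 1 by rewrite subr_gt0.
have r0 : (0 < r)%N.
  by rewrite /r truncn_gt0 -invr1 lef_pV2 ?posrE ?ltr01//; lra.
have pr : (p - 1) * r%:R <= 1.
  by rewrite mulrC -ler_pdivlMr// mul1r truncn_le ?invr_ge0// ltW.
have qr : 1 < q * r%:R.
  have : (p - 1)^-1 < r.+1%:R by exact: truncnS_gt.
  rewrite -natr1 -ltrBlDr (_ : _ - 1 = q^-1); last first.
    by rewrite /q; field; rewrite !gt_eqF// subr_gt0.
  by rewrite -[q^-1]div1r ltr_pdivrMr// mulrC.
have [Z hZ] := sum_powR_bounded qr.
pose a j := b * j.+1%:R `^ q.
have a0 j : 0 < a j by rewrite mulr_gt0 ?powR_gt0.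
(* In the tail u_(j+1) <= e^(-a_j) already gives the geometric bound with constant 1; the finitely
   many other indices use [exprn_fact_le_geom]. *)
pose c j := if (J <= j.+1)%N then 0 else u j.+1 * expR (a j).
have c0 j : 0 <= c j by rewrite /c; case: ifP => // _; rewrite mulr_ge0 ?expR_ge0 ?ltW.
have uc0 j : 0 <= u j.+1 + c j by rewrite addr_ge0// ltW.
have ar0 j : 0 < a j ^+ r by rewrite exprn_gt0.
(* The sum handles the indices before the tail, r! handles the tail through e^(-a) <= r! a^(-r), and
   1 handles the term a_j^(-r) itself. *)
pose M := \sum_(j < J) (u j.+1 + c j) * a j ^+ r + r`!%:R + 1.
have S0 : 0 <= \sum_(j < J) (u j.+1 + c j) * a j ^+ r.
  by apply: sumr_ge0 => j _; rewrite mulr_ge0// ltW.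
have hM j : u j.+1 + c j + (a j ^+ r)^-1 <= M * (a j ^+ r)^-1.
  rewrite /M mulrDl mul1r lerD2r -ler_pdivrMr ?invr_gt0// invrK.
  have [Jj|jJ] := leqP J j.+1; last first.
    rewrite (bigD1 (Ordinal (ltnW jJ)))//= -addrA lerDl addr_ge0//.
    by apply: sumr_ge0 => i _; rewrite mulr_ge0// ltW.
  rewrite /c Jj addr0 -[leLHS]add0r lerD//.
  apply: (@le_trans _ _ (expR (- a j) * a j ^+ r)); first by apply: ler_wpM2r; [exact: ltW|exact: hb].
  rewrite expRN mulrC ler_pdivrMr ?expR_gt0//.
  by rewrite -ler_pdivrMl ?ltr0n ?fact_gt0// mulrC; apply/exprn_fact_le_expR/ltW.
pose A := M * b ^- r * Z.
have hA s : \sum_(j < s) (u j.+1 + c j + (a j ^+ r)^-1) <= A.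
  apply: (@le_trans _ _ (\sum_(j < s) M * b ^- r * (j.+1%:R `^ (q * r%:R))^-1)).
    apply: ler_sum => j _; apply: (le_trans (hM j)).
    by rewrite /a exprMn invfM -(powR_mulrn _ (powR_ge0 _ _)) -powRrM mulrA.
  rewrite -mulr_sumr ler_wpM2l// mulr_ge0 ?invr_ge0 ?exprn_ge0 ?(ltW b0)//.
  by rewrite /M !addr_ge0.
have A0 : 0 <= A by have := hA 0%N; rewrite big_ord0.
exists (error_factor r A), (rate r A / 2); split; first exact: ltW.
split; first exact: rate0.
move=> s n _ n0; apply: (@F_minimal_error_decay _ s u a c) => // j k.
rewrite /c; case: ifP => [Jj|_]; last by apply: exprn_fact_le_geom; exact: ltW.
rewrite expR0 mul1r (le_trans (_ : _ <= u j.+1 ^+ k))//.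
  rewrite ler_pdivrMr ?ltr0n ?fact_gt0//; apply: ler_peMr.
    exact/exprn_ge0/ltW.
  by rewrite ler1n fact_gt0.
rewrite -mulNr mulrC expRM_natl; apply: lerXn2r; last exact: hb.
- by rewrite nnegrE ltW.
- by rewrite nnegrE expR_ge0.
Qed.
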